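(* For an arbitrary topological group $G$ the following conditions are equivalent. (1) Every continuous action of $G$ on a compact space is weakly almost periodic. (2) Every bounded right uniformly continuous function on $G$ is weakly almost periodic. (3) $G$ is precompact.
   Context: Topological groups and compact spaces are Hausdorff. A continuous action of a topological group $G$ on a compact space $X$ is a jointly continuous action $G\times X\to X$. For a set $X$, $l^\infty(X)$ is the Banach space of all bounded complex-valued functions on $X$ with the supremum norm. If a group $G$ acts on $X$, it acts on $l^\infty(X)$ by $(g\cdot f)(x)=f(g^{-1}x)$. A bounded function $f$ on $X$ is weakly almost periodic if its $G$-orbit $\{g\cdot f: g\in G\}$ is relatively compact in the weak topology of the Banach space $l^\infty(X)$. An action of $G$ by homeomorphisms on a compact space $X$ is weakly almost periodic if every continuous complex-valued function on $X$ is weakly almost periodic. A bounded function on a group $G$ is called weakly almost periodic if it is weakly almost periodic with respect to the action of $G$ on itself by left translations (it is a known fact that using right translations gives the same notion). A continuous function $f:G\to\mathbb{C}$ on a topological group $G$ is right uniformly continuous if for every $\varepsilon>0$ there is a neighbourhood $V$ of the identity such that for all $x,y\in G$, $xy^{-1}\in V$ implies $|f(y)-f(x)|<\varepsilon$. A topological group is precompact if it is isomorphic (as a topological group) to a topological subgroup of a compact group. *)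

(* Defs.v *)
From HB Require Import structures.
From mathcomp Require Import all_boot all_order all_algebra.
From mathcomp Require Import complex.
From mathcomp Require Import all_classical all_reals all_analysis.

Set Implicit Arguments.
Unset Strict Implicit.
Unset Printing Implicit Defensive.

Import Order.TTheory GRing.Theory Num.Theory.
Import numFieldNormedType.Exports.
Import ComplexField.Normc.

Local Open Scope classical_set_scope.
Local Open Scope ring_scope.
Local Open Scope complex_scope.

(* The Hausdorff axiom is not part of this structure: it is a separate
   hypothesis [hausdorff_space G] wherever a topological group occurs. *)
HB.mixin Record isTopologicalGroup G & Group G & Topological G := {
  mulg_continuous : continuous (fun p : G * G => (p.1 * p.2)%g) ;
  invg_continuous : continuous (fun x : G => (x^-1)%g)
}.

#[short(type="topologicalGroupType")]
HB.structure Definition TopologicalGroup :=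
  {G of Group G & Topological G & isTopologicalGroup G}.

Definition group_action (G : groupType) (X : Type) (act : G -> X -> X) : Prop :=
  (forall x, act 1%g x = x) /\
  (forall g h x, act (g * h)%g x = act g (act h x)).

Definition continuous_action (G : topologicalGroupType) (X : topologicalType)
    (act : G -> X -> X) : Prop :=
  group_action act /\ continuous (fun p : G * X => act p.1 p.2).

Section weak_topology_of_normed_space.
Variables (K : numFieldType) (V : normedModType K).

Definition topological_dual : Type :=
  {phi : {linear V -> K^o} | continuous (phi : V -> K^o)}.

Definition weakTopology : Type :=
  sup_topology (fun phi : topological_dual =>
    Topological.on (initial_topology (sval phi : V -> K^o))).

End weak_topology_of_normed_space.

Section linfty.
Variables (R : realType) (X : Type).

Definition bounded_functions : {pred X -> R[i]^o} :=
  mem (bounded_fun : set (X -> R[i]^o)).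

Lemma bounded_functionsP (f : X -> R[i]^o) :
  f \in bounded_functions <-> exists M : R, forall x, normc (f x) <= M.
Proof.
rewrite /bounded_functions inE; split=> [|[M fM]].
  move=> /pinfty_ex_gt0[M M0 fM]; exists (complex.Re M) => x.
  by have := fM x Logic.I; rewrite /= lecE /= => /andP[].
exists M%:C; split; first by apply/complex_realP; exists M.
move=> y My x _ /=; apply: le_trans (ltW My).
by rewrite -[`|_|]/((normc (f x))%:C) lecR.
Qed.

Lemma bounded_functions_submod_closed : submod_closed bounded_functions.
Proof.
split; first by apply/bounded_functionsP; exists 0 => x; rewrite normc0.
move=> a f g /bounded_functionsP[M fM] /bounded_functionsP[N gN].
apply/bounded_functionsP; exists (normc a * M + N) => x.
rewrite (le_trans (le_normcD _ _))// lerD// normcM ler_wpM2l//.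
by rewrite -ler0c; exact: (normr_ge0 a).
Qed.

HB.instance Definition _ := GRing.isSubmodClosed.Build _ _ bounded_functions
  bounded_functions_submod_closed.

Record linfty : Type := Linfty {
  linfty_fun :> X -> R[i]^o ;
  linfty_bounded : linfty_fun \in bounded_functions
}.

HB.instance Definition _ := [isSub for linfty_fun].
HB.instance Definition _ := [Choice of linfty by <:].
HB.instance Definition _ := [SubChoice_isSubLmodule of linfty by <:].

(* [normc] is the [R]-valued modulus: [`|z| = (normc z)%:C]. A norm on an
   [R[i]]-module is [R[i]]-valued in the library, whence the injection [%:C].
   When [X] is empty the supremum is [sup set0 = 0]. *)
Definition linfty_norm (f : linfty) : R[i] :=
  (sup (range (fun x => normc (f x))))%:C.

Lemma normc_le_linfty_norm (f : linfty) x :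
  normc (f x) <= sup (range (fun x => normc (f x))).
Proof.
have /bounded_functionsP[M fM] := linfty_bounded f.
apply: ub_le_sup; last by exists x.
by exists M => _ [y _ <-].
Qed.

Lemma linfty_norm_le (f : linfty) (M : R) :
  0 <= M -> (forall x, normc (f x) <= M) -> linfty_norm f <= M%:C.
Proof.
move=> M0 fM; rewrite /linfty_norm lecR.
have [->|/set0P ne0] := eqVneq (range (fun x => normc (f x))) set0.
  by rewrite sup0.
by apply: ge_sup => // _ [x _ <-].
Qed.

Lemma linfty_sup_ge0 (f : linfty) : 0 <= sup (range (fun x => normc (f x))).
Proof.
have [->|/set0P[_ [x _ _]]] := eqVneq (range (fun x => normc (f x))) set0.
  by rewrite sup0.
apply: le_trans (normc_le_linfty_norm f x).
by rewrite -ler0c; exact: (normr_ge0 (f x)).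
Qed.

Lemma ler_linfty_normD f g :
  linfty_norm (f + g) <= linfty_norm f + linfty_norm g.
Proof.
rewrite {2 3}/linfty_norm -rmorphD; apply: linfty_norm_le => [|x].
  by apply: addr_ge0; exact: linfty_sup_ge0.
by rewrite (le_trans (le_normcD _ _))// lerD// normc_le_linfty_norm.
Qed.

Lemma linfty_normZ (a : R[i]) f : linfty_norm (a *: f) = `|a| * linfty_norm f.
Proof.
have normcP (z : R[i]) : 0 <= normc z by rewrite -ler0c; exact: (normr_ge0 z).
have le b (g : linfty) : linfty_norm (b *: g) <= `|b| * linfty_norm g.
  rewrite -[`|b|]/((normc b)%:C) {2}/linfty_norm -rmorphM.
  apply: linfty_norm_le => [|x].
    by apply: mulr_ge0; [exact: normcP | exact: linfty_sup_ge0].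
  by rewrite -[(b *: g) x]/(b * g x) normcM ler_wpM2l// normc_le_linfty_norm.
apply/eqP; rewrite eq_le le /=.
have [->|a0] := eqVneq a 0.
  by rewrite normr0 mul0r /linfty_norm ler0c linfty_sup_ge0.
rewrite mulrC -ler_pdivlMr ?normr_gt0//.
by have := le a^-1 (a *: f); rewrite scalerK// normfV mulrC.
Qed.

Lemma linfty_norm_eq0 f : linfty_norm f = 0 -> f = 0.
Proof.
move=> /complexI f0; apply/val_inj/funext => x; apply: eq0_normc.
apply/eqP; rewrite eq_le -{1}f0 normc_le_linfty_norm /=.
by rewrite -ler0c; exact: (normr_ge0 (f x)).
Qed.

HB.instance Definition _ := Lmodule_isNormed.Build R[i] linfty
  ler_linfty_normD linfty_normZ linfty_norm_eq0.

End linfty.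

Section weakly_almost_periodic.
Variables (R : realType) (G : groupType) (X : Type) (act : G -> X -> X).

Lemma translate_bounded (g : G) (f : linfty R X) :
  (fun x => f (act g^-1%g x)) \in @bounded_functions R X.
Proof.
have /bounded_functionsP[M fM] := linfty_bounded f.
by apply/bounded_functionsP; exists M => x.
Qed.

Definition translate (g : G) (f : linfty R X) : linfty R X :=
  Linfty (translate_bounded g f).

Definition orbit_of (f : linfty R X) : set (linfty R X) :=
  range (fun g : G => translate g f).

(* The first clause makes boundedness of [f] part of the notion. The library's
   [precompact A] is [compact (closure A)] ([precompactE]); here the closure and
   compactness are those of the weak topology, not of the norm topology. *)
Definition weakly_almost_periodic (f : X -> R[i]^o) : Prop :=
  exists2 F : linfty R X, F = f :> (X -> R[i]^o) &
    @precompact (weakTopology (linfty R X)) (orbit_of F).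

End weakly_almost_periodic.

Definition weakly_almost_periodic_action (R : realType) (G : groupType)
    (X : topologicalType) (act : G -> X -> X) : Prop :=
  forall f : X -> R[i]^o, continuous f -> weakly_almost_periodic act f.

Definition left_translation (G : groupType) (g x : G) : G := (g * x)%g.

Definition right_uniformly_continuous (R : realType)
    (G : topologicalGroupType) (f : G -> R[i]^o) : Prop :=
  continuous f /\
  forall eps : R, 0 < eps ->
    exists2 V : set G, nbhs 1%g V &
      forall x y, V (x * y^-1)%g -> `|f y - f x| < eps%:C.

(* The subgroup [H] carries the subspace topology of [K] (the library's
   topology on the subtype of a set) and its group law is that of [K]. *)
Definition isomorphic_to_subgroup (G K : topologicalGroupType) (H : set K) :
    Prop :=
  exists (phi : G -> H) (psi : H -> G),
    [/\ cancel phi psi, cancel psi phi,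
        {morph (fun x => set_val (phi x)) : x y / (x * y)%g},
        continuous phi & continuous psi].

Definition precompact_group (G : topologicalGroupType) : Prop :=
  exists (K : topologicalGroupType) (H : set K),
    [/\ hausdorff_space K, compact [set: K], group_closed (mem H)
      & isomorphic_to_subgroup G H].

(* Main.v *)
(** (1) => (2): a bounded right uniformly continuous [f] extends along
    [x |-> (h |-> f (h x))] to a continuous function on a compact [G]-space of
    functions on [G], and restriction to [G] is weakly continuous.

    (2) => (3): if some neighbourhood [V] of [1] satisfies [G <> F V F] for all
    finite [F], one picks inductively sequences such that the sets
    [{g_n x_m : n <= m}] and [{g_n x_m : m < n}] are [V]-apart. A right uniformly
    continuous function separating them violates the double limit condition, so
    it is not weakly almost periodic. Hence [G = F V F] for all [V] and suitable
    finite [F]. A finite cover of [G] has a member [A] with [G = F A A^-1], [F]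
    finite, and for [A = a V b] this gives [G = F' V V^-1]: the group is totally
    bounded. Its topology is then given by totally bounded bi-invariant
    pseudometrics, and [G] embeds in the product of the corresponding compact
    metric completions.

    (3) => (1): a precompact group is totally bounded and acts uniformly
    equicontinuously on a compact space, so orbits of continuous functions are
    totally bounded in norm. *)

Require Import Defs.
From HB Require Import structures.
From mathcomp Require Import all_boot all_order all_algebra.
From mathcomp Require Import complex.
From mathcomp Require Import all_classical all_reals all_analysis.
From mathcomp Require Import ring lra.

Set Implicit Arguments.
Unset Strict Implicit.
Unset Printing Implicit Defensive.

Import Order.TTheory GRing.Theory Num.Theory.
Import numFieldNormedType.Exports.
Import ComplexField.Normc.

Local Open Scope classical_set_scope.
Local Open Scope ring_scope.
Local Open Scope complex_scope.

(** * Finite covers of groups *)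

Section thick_sets.
Variable G : groupType.
Implicit Types (A T : set G) (E F : seq G).

(** Thick sets of topological dynamics; a set is thick exactly when its complement is not
    syndetic. *)
Definition thick T := forall E, exists x, forall e, e \in E -> T (e * x)%g.

(** The product set [F A]. *)
Definition left_hull F A : set G := [set x | exists2 a, a \in F & A (a^-1 * x)%g].

(** Induction on [n]. If [A n] is not thick, some finite [E] has no right translate inside it; then
    the union of the sets [E^-1 A i] with [i < n] is still thick, and a hull [F E^-1 A i] is again a
    finite hull of [A i]. *)
Lemma thick_partition n (A : nat -> set G) T :
    thick T -> (forall x, T x -> exists2 i, (i < n)%N & A i x) ->
  exists2 i, (i < n)%N & exists F, thick (left_hull F (A i)).
Proof.
elim: n A T => [|n IHn] A T thT TA.
  by have [x /(_ 1%g (mem_head _ _))/TA[]] := thT [:: 1%g].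
have [thAn|] := pselect (thick (A n)).
  exists n => //; exists [:: 1%g] => E; have [x Ex] := thAn E.
  by exists x => e /Ex Aex; exists 1%g; rewrite ?mem_head// invg1 mul1g.
move=> /existsNP[E /forallNP EAn].
pose A' i : set G := [set x | exists2 e, e \in E & A i (e * x)%g].
pose T' : set G := [set x | exists2 i, (i < n)%N & A' i x].
have thT' : thick T'.
  move=> E0; have [x Tx] := thT [seq (e * e0)%g | e <- E, e0 <- E0].
  exists x => e0 e0E0; have /existsNP[e /not_implyP[eE nAn]] := EAn (e0 * x)%g.
  have [|i] := TA (e * e0 * x)%g; first by apply: Tx; exact: allpairs_f.
  rewrite ltnS leq_eqVlt -mulgA => /predU1P[->//|ltin Ai].
  by exists i => //; exists e.
have [//|i ltin [F thF]] := IHn A' T' thT'.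
exists i; first exact: ltnW.
exists [seq (a * e^-1)%g | a <- F, e <- E] => E0; have [x xP] := thF E0.
exists x => e0 /xP[a aF [e eE Ai]]; exists (a * e^-1)%g.
  exact: (allpairs_f (fun a e => (a * e^-1)%g)).
by rewrite invgM invgK -mulgA.
Qed.

(* Apply thickness to [1] and all the [h f^-1], [f \in F]: some right translate of
   these elements by [x] lies in [F A]; say [x = a y] and [h a^-1 x = b z]. *)
Lemma left_hull_thick_diff F A : thick (left_hull F A) ->
  exists F', forall h, exists a z y,
    [/\ a \in F', A z, A y & h = (a * (z * y^-1))%g].
Proof.
move=> thF; exists F => h; have [x xP] := thF (1%g :: [seq (h * f^-1)%g | f <- F]).
have [a aF] := xP 1%g (mem_head _ _); rewrite mul1g => Ay.
have [|b bF Az] := xP (h * a^-1)%g.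
  by rewrite inE (map_f (fun f => h * f^-1)%g aF) orbT.
exists b, (b^-1 * (h * a^-1 * x))%g, (a^-1 * x)%g; split => //.
by rewrite invgM invgK -!mulgA mulVKg mulVKg mulVg mulg1.
Qed.

(** As [G] is thick, one cell [A = p U q] of the cover satisfies [G = F' A A^-1]. Here [q] cancels,
    [A A^-1 = p U U^-1 p^-1], and the decomposition of [h p^-1] gives that of [h]. *)
Lemma two_sided_cover (U : set G) (s : seq (G * G)) :
    (forall x, exists p u, [/\ p \in s, U u & x = (p.1 * u * p.2)%g]) ->
  exists F, forall h, exists a z y,
    [/\ a \in F, U z, U y & h = (a * (z * y^-1))%g].
Proof.
move=> sU; pose p0 : G * G := (1%g, 1%g).
pose A i : set G := [set ((nth p0 s i).1 * u * (nth p0 s i).2)%g | u in U].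
have thT : thick [set: G] by move=> E; exists 1%g.
have [|i _ [F /left_hull_thick_diff[F' F'P]]] := @thick_partition (size s) A _ thT.
  move=> x _; have [p [u [ps Uu ->]]] := sU x; exists (index p s).
    by rewrite index_mem.
  by exists u => //; rewrite nth_index.
set p := nth p0 s i in A F'P; exists [seq (a * p.1)%g | a <- F'] => h.
have [a [_ [_ [aF' [z Uz <-] [y Uy <-] hE]]]] := F'P (h * p.1^-1)%g.
exists (a * p.1)%g, z, y; split => //; first exact: (map_f (fun a => a * p.1)%g).
apply: (mulIg p.1^-1%g); rewrite hE.
by rewrite !invgM -!mulgA mulVKg.
Qed.

End thick_sets.

(** * Topological groups and their right uniformity *)

Section topological_groups.
Variable G : topologicalGroupType.
Implicit Types (U V : set G) (x y : G).

Lemma nbhs_mulg x y V : nbhs (x * y)%g V ->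
  exists U W, [/\ nbhs x U, nbhs y W & forall u w, U u -> W w -> V (u * w)%g].
Proof.
move=> Vxy; have := @mulg_continuous G (x, y) V Vxy.
move=> [[U W] [/= Ux Wy] UWV]; exists U, W; split=> // u w Uu Ww.
by apply: (UWV (u, w)).
Qed.

Lemma nbhs_divg x y V : nbhs (x * y^-1)%g V ->
  exists U W, [/\ nbhs x U, nbhs y W & forall u w, U u -> W w -> V (u * w^-1)%g].
Proof.
move=> /nbhs_mulg[U [W [Ux Wy UWV]]]; exists U, [set w | W w^-1%g]; split => //.
  exact: (@invg_continuous G y).
by move=> u w /UWV + /= => /[apply].
Qed.

Lemma nbhs1_div V : nbhs 1%g V ->
  exists2 U, nbhs 1%g U & forall u w, U u -> U w -> V (u * w^-1)%g.
Proof.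
move=> V1; have [|U [W [U1 W1 UWV]]] := @nbhs_divg 1%g 1%g V.
  by rewrite invg1 mulg1.
by exists (U `&` W) => [|u w [Uu _] [_ Ww]]; [exact: filterI|exact: UWV].
Qed.

Lemma nbhs1_mul V : nbhs 1%g V ->
  exists2 U, nbhs 1%g U & forall u w, U u -> U w -> V (u * w)%g.
Proof.
move=> V1; have [|U [W [U1 W1 UWV]]] := @nbhs_mulg 1%g 1%g V; first by rewrite mulg1.
by exists (U `&` W) => [|u w [Uu _] [_ Ww]]; [exact: filterI|exact: UWV].
Qed.

Lemma nbhs1_inv V : nbhs 1%g V -> nbhs 1%g [set u | V u^-1%g].
Proof. by move=> V1; apply: (@invg_continuous G 1%g); rewrite invg1. Qed.

Lemma mulgl_continuous x : continuous (fun y : G => x * y)%g.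
Proof.
move=> y V /nbhs_mulg[U [W [Ux Wy UWV]]]; apply: filterS Wy => w.
by apply: UWV; exact: nbhs_singleton.
Qed.

Lemma mulgr_continuous x : continuous (fun y : G => y * x)%g.
Proof.
move=> y V /nbhs_mulg[U [W [Ux Wy UWV]]]; apply: filterS Ux => w Uw.
by apply: UWV => //; exact: nbhs_singleton.
Qed.

Lemma nbhs1_conj a V : nbhs 1%g V -> nbhs 1%g [set u | V (a * u * a^-1)%g].
Proof.
move=> V1; apply: (@mulgl_continuous a 1%g [set u | V (u * a^-1)%g]).
by apply: (@mulgr_continuous a^-1%g (a * 1)%g V); rewrite mulg1 mulgV.
Qed.

Lemma nbhs1_right V x : nbhs 1%g V -> nbhs x [set y | V (x * y^-1)%g].
Proof.
move=> V1; apply: (@invg_continuous G x [set y | V (x * y)%g]).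
by apply: (@mulgl_continuous x x^-1%g V); rewrite mulgV.
Qed.

Definition totally_bounded_group :=
  forall V, nbhs 1%g V -> exists F : seq G, forall x, exists2 a, a \in F & V (a^-1 * x)%g.

(** The covers supplied by [two_sided_cover] use [U U^-1], so it is applied to a [U] with [U U^-1]
    inside [V]. *)
Lemma two_sided_totally_bounded :
    (forall V, nbhs 1%g V -> exists s : seq (G * G), forall x,
       exists p u, [/\ p \in s, V u & x = (p.1 * u * p.2)%g]) ->
  totally_bounded_group.
Proof.
move=> cov V /nbhs1_div[U /cov[s /two_sided_cover[F FP]] UV]; exists F => x.
have [a [z [y [aF Uz Uy ->]]]] := FP x.
by exists a => //; rewrite mulKg; exact: UV.
Qed.

End topological_groups.

(** The alias keeps the topology induced by the right uniformity apart from the one given on [G]. *)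
Definition right_uniform_space (G : topologicalGroupType) : Type := G.

Section right_uniformity.
Variable G : topologicalGroupType.
Local Notation rG := (right_uniform_space G).
Local Open Scope relation_scope.

Let ent : set_system (rG * rG) :=
  [set E | exists2 V : set G, nbhs 1%g V & forall x y : G, V (x * y^-1)%g -> E (x, y)].

Let ent_filter : Filter ent.
Proof.
split.
- by exists setT => //; exact: filterT.
- move=> P Q [V V1 VP] [W W1 WQ]; exists (V `&` W); first exact: filterI.
  by move=> x y [/VP ? /WQ].
- by move=> P Q PQ [V V1 VP]; exists V => // x y /VP/PQ.
Qed.

Let ent_diagonal A : ent A -> diagonal `<=` A.
Proof.
move=> [V V1 VA] [x y]/diagonalP ->; apply: VA.
by rewrite mulgV; exact: nbhs_singleton.
Qed.

Let ent_inv A : ent A -> ent A^-1.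
Proof.
move=> [V V1 VA]; exists [set u | V u^-1%g]; first exact: nbhs1_inv.
by move=> x y /=; rewrite invgM invgK => /VA.
Qed.

Let ent_split A : ent A -> exists2 B, ent B & B \; B `<=` A.
Proof.
move=> [V /nbhs1_mul[U U1 UV] VA].
exists [set p : rG * rG | U ((p.1 : G) * (p.2 : G)^-1)%g]; first by exists U.
move=> [x z] [y /= xy yz]; apply: VA.
by have := UV _ _ xy yz; rewrite mulgA mulgVK.
Qed.

HB.instance Definition _ := Choice.on rG.
HB.instance Definition _ :=
  @isUniform.Build rG ent ent_filter ent_diagonal ent_inv ent_split.

Lemma right_entourageP (E : set (rG * rG)) :
  entourage E <->
  exists2 V : set G, nbhs 1%g V & forall x y : G, V (x * y^-1)%g -> E (x, y).
Proof. by []. Qed.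

End right_uniformity.

Lemma ball_separation (R : realType) (T : pseudoMetricType R) (A B : set T) (e : R) :
    0 < e -> (forall a b, A a -> B b -> ~ ball a e b) ->
  exists f : T -> R, [/\ forall x, 0 <= f x <= 1, forall a, A a -> f a = 0,
     forall b, B b -> f b = 1 &
     forall x y (r : R), 0 < r -> ball x (r * e) y -> `|f x - f y| <= r].
Proof.
move=> e0 AB.
(* [inf (S x)] is the distance from [A] to [x] in units of [e], truncated at 1. *)
pose S x := [set r : R | 0 < r /\ (r = 1 \/ exists2 a, A a & ball a (r * e) x)].
have S1 x : S x 1 by split; [exact: ltr01|left].
have Slb x : has_lbound (S x) by exists 0 => r [/ltW].
have S_ge0 x : 0 <= inf (S x) by apply: lb_le_inf; [exists 1|move=> r [/ltW]].
have lip x y r : 0 < r -> ball x (r * e) y -> inf (S y) <= inf (S x) + r.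
  move=> r0 xy; rewrite -lerBlDr; apply: lb_le_inf; first by exists 1.
  move=> s [s0 [->|[a Aa ax]]]; rewrite lerBlDr.
    by apply: le_trans (ge_inf (Slb y) (S1 y)) _; rewrite lerDl ltW.
  apply: (ge_inf (Slb y)); split; first exact: addr_gt0.
  by right; exists a => //; rewrite mulrDl; exact: ball_triangle ax xy.
exists (fun x => inf (S x)); split.
- by move=> x; rewrite S_ge0 /=; exact: ge_inf.
- move=> a Aa; apply/eqP; rewrite eq_le S_ge0 andbT.
  apply/ler_addgt0Pr => r r0; rewrite add0r; apply: ge_inf => //; split => //.
  by right; exists a => //; apply: ballxx; exact: mulr_gt0.
- move=> b Bb; apply/eqP; rewrite eq_le ge_inf//=.
  apply: lb_le_inf; first by exists 1.
  move=> r [r0 [->//|[a Aa ab]]]; rewrite leNgt; apply/negP => r1.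
  apply: (AB a b) => //; apply: le_ball ab.
  by rewrite ler_piMl ?ltW.
- move=> x y r r0 xy.
  have h1 := lip x y r r0 xy; have h2 := lip y x r r0 (ball_sym xy).
  by rewrite ler_norml; apply/andP; split; lra.
Qed.

(** The single entourage given by [V] generates a coarser, pseudometrizable uniformity, in which [A]
    and [B] are at positive distance. A function that is Lipschitz there is right uniformly
    continuous, because entourages of the gauge are entourages of the right uniformity. *)
Lemma right_uniform_urysohn (R : realType) (G : topologicalGroupType)
    (A B V : set G) :
    nbhs 1%g V -> (forall a b, A a -> B b -> ~ V (a * b^-1)%g) ->
  exists f : G -> R, [/\ forall x, 0 <= f x <= 1, forall a, A a -> f a = 0,
     forall b, B b -> f b = 1 &
     forall r, 0 < r -> exists2 W : set G, nbhs 1%g W &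
       forall x y, W (x * y^-1)%g -> `|f x - f y| < r].
Proof.
move=> V1 AB; pose rG := right_uniform_space G.
pose E : set (rG * rG) := [set p | V ((p.1 : G) * (p.2 : G)^-1)%g].
have entE : entourage E by apply/right_entourageP; exists V.
pose T : pseudoMetricType R := gauge.type entE.
have : @entourage T E by exists O => // -[x y] [].
rewrite -entourage_ballE => -[e e0 eE].
have [|f [f01 fA fB flip]] := @ball_separation R T A B e e0.
  by move=> a b Aa Bb ab; apply: (AB a b) => //; exact: (eE (a, b)).
exists f; split => // r r0.
have re0 : 0 < r / 2 * e by rewrite mulr_gt0 ?divr_gt0.
have : @entourage T [set p | ball p.1 (r / 2 * e) p.2] by exact: entourage_ball (PosNum re0).
move=> /(gauge.gauge_ent entE)/right_entourageP[W W1 WE]; exists W => // x y /WE.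
move=> /flip h; apply: le_lt_trans (h _) _; first by rewrite divr_gt0.
by rewrite ltr_pdivrMr// ltr_pMr// ltr1n.
Qed.

(** * Weak topologies and bounded functions *)

Section complex_topology.
Variable R : realType.
Implicit Types (z : R[i]^o) (e : R).

Lemma normc_ge0 (z : R[i]) : 0 <= normc z.
Proof. by rewrite -ler0c; exact: (normr_ge0 z). Qed.

Lemma normcB (x y : R[i]) : normc (x - y) = normc (y - x).
Proof. by rewrite -normcN opprB. Qed.

Lemma normc_real (x : R) : normc x%:C = `|x|.
Proof. by rewrite /normc /= expr0n /= addr0 sqrtr_sqr. Qed.

Lemma normc_le_ReIm (z : R[i]) : normc z <= `|complex.Re z| + `|complex.Im z|.
Proof.
case: z => a b; rewrite /normc /= -[leRHS]ger0_norm ?addr_ge0// -[leRHS]sqrtr_sqr.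
rewrite ler_wsqrtr// sqrrD !real_normK ?num_real//.
by rewrite -addrA lerD2l lerDr mulrn_wge0// mulr_ge0.
Qed.

Lemma ge_Re_normc (z : R[i]) : `|complex.Re z| <= normc z.
Proof. by rewrite -lecR; exact: normc_ge_Re. Qed.

Lemma ge_Im_normc (z : R[i]) : `|complex.Im z| <= normc z.
Proof.
case: z => a b; rewrite /normc /= -sqrtr_sqr ler_wsqrtr// lerDr.
exact: sqr_ge0.
Qed.

Lemma complex_cvgP (T : Type) (F : set_system T) {FF : Filter F} (h : T -> R[i]^o) z :
  h @ F --> z <-> forall e, 0 < e -> \forall t \near F, normc (h t - z) < e.
Proof.
split=> [/cvgrPdist_lt + e e0|cv].
  move=> /(_ e%:C); rewrite ltcR => /(_ e0); apply: filterS => t /=.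
  by rewrite -[`|_|]/((normc (z - h t))%:C) ltcR normcB.
apply/cvgrPdist_lt => e; rewrite ltcE /= => /andP[/eqP e_im e0].
apply: filterS (cv _ e0) => t /=.
rewrite -[`|_|]/((normc (z - h t))%:C) ltcE /= => ht.
by rewrite -e_im eqxx normcB.
Qed.

Lemma complex_square_compact (M : R) :
  compact [set z : R[i]^o | `|complex.Re z| <= M /\ `|complex.Im z| <= M].
Proof.
pose f (p : R * R) : R[i]^o := p.1 +i* p.2.
have cf : continuous f.
  move=> [a b]; apply/complex_cvgP => e e0.
  have e20 : 0 < e / 2 by rewrite divr_gt0.
  exists (ball a (e / 2), ball b (e / 2)).
    by split; exact: nbhsx_ballx.
  move=> [c d] [/= ac bd].
  apply: (@le_lt_trans _ _ (`|c - a| + `|d - b|)).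
    exact: (normc_le_ReIm (f (c, d) - f (a, b))).
  by rewrite [ltRHS](splitr e) (distrC c) (distrC d); exact: ltrD.
have -> : [set z : R[i]^o | `|complex.Re z| <= M /\ `|complex.Im z| <= M] =
    f @` (`[- M, M] `*` `[- M, M]).
  apply/seteqP; split => [[a b] /= [aM bM]|_ [[a b]] /= [aM bM] <- /=].
    by exists (a, b) => //=; rewrite !in_itv /= -!ler_norml.
  by move: aM bM; rewrite !in_itv /= -!ler_norml.
apply: continuous_compact; first exact: continuous_subspaceT.
by apply: compact_setX; exact: segment_compact.
Qed.

Lemma ultra_map (T U : Type) (F : set_system T) (h : T -> U) :
  UltraFilter F -> UltraFilter (h @ F).
Proof.
move=> FU; split; first exact: fmap_proper_filter.
move=> H HF FH; apply/seteqP; split => // A HA.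
have [//|nA] := in_ultra_setVsetC (h @^-1` A) FU.
have /filter_ex[? []//] : H (A `&` ~` A) by apply: filterI => //; exact: FH.
Qed.

(** The limit is found in a compact square, whence the crude bound [M + M] from the real and
    imaginary parts; any multiple of [M] serves for continuity of functionals. *)
Lemma ultra_bounded_cvg (T : Type) (F : set_system T) (h : T -> R[i]^o) (M : R) :
    UltraFilter F -> (forall t, normc (h t) <= M) ->
  exists l : R[i]^o, h @ F --> l /\ normc l <= M + M.
Proof.
move=> FU hM; have := @complex_square_compact M.
rewrite compact_ultra => /(_ (h @ F) (ultra_map h FU))[|l [[lRe lIm] hl]].
  apply: (@filterE _ F) => t /=.
  by split; apply: le_trans (hM t); [exact: ge_Re_normc|exact: ge_Im_normc].
by exists l; split => //; apply: le_trans (normc_le_ReIm _) _; exact: lerD.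
Qed.

Lemma ultra_finite_cover (T : Type) (I : eqType) (F : set_system T) (A : I -> set T)
    (s : seq I) :
    UltraFilter F -> F [set t | exists2 i, i \in s & A i t] ->
  exists2 i, i \in s & F (A i).
Proof.
move=> FU; elim: s => [|i s IHs] Fs; first by have [t []] := filter_ex Fs.
have [FA|FA] := in_ultra_setVsetC (A i) FU; first by exists i; rewrite ?mem_head.
have [|j js FAj] := IHs; last by exists j; rewrite // inE js orbT.
apply: filterS (filterI Fs FA) => t [[j + Ajt] nAit].
by rewrite inE => /predU1P[ji|js]; [rewrite ji in Ajt|exists j].
Qed.

End complex_topology.

Lemma hausdorff_separated (T : topologicalType) :
    (forall p q : T, p <> q -> exists (U : topologicalType) (f : T -> U),
      [/\ hausdorff_space U, continuous f & f p <> f q]) ->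
  hausdorff_space T.
Proof.
move=> sep p q pq; apply: contrapT => /sep[U [f [hU cf]]]; apply.
apply: hU => A B /cf fA /cf fB; have [x [Ax Bx]] := pq _ _ fA fB.
by exists (f x).
Qed.

(** * Initial topologies of families of maps: weak and pointwise topologies *)

Section initial_family.
Variables (T : choiceType) (I : Type) (U : topologicalType) (ev : I -> T -> U).
Local Notation S := (sup_topology (fun i => Topological.on (initial_topology (ev i)))).

Lemma sup_initial_cvgP (F : set_system T) {FF : Filter F} (t : T) :
  F --> (t : S) <-> forall i, ev i @ F --> ev i t.
Proof.
rewrite cvg_sup; split => cv i.
  by move=> A /(@initial_continuous _ _ (ev i) t) /(cv i).
move=> A [_ [[B oB <-] Bt BA]]; apply: (@filterS _ F _ _ _ BA); apply: (cv i).
exact: open_nbhs_nbhs.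
Qed.

Lemma sup_initial_continuous i : continuous (ev i : S -> U).
Proof.
move=> t; have [+ _] := @sup_initial_cvgP _ (nbhs_filter (t : S)) t.
by move=> /(_ (fun _ h => h) i).
Qed.

Lemma sup_initial_hausdorff : hausdorff_space U ->
  (forall s t, (forall i, ev i s = ev i t) -> s = t) -> hausdorff_space S.
Proof.
move=> hU sep; apply: hausdorff_separated => s t st.
have /existsNP[i evst] : ~ forall i, ev i s = ev i t by move=> /sep.
by exists U, (ev i); split => //; exact: sup_initial_continuous.
Qed.

End initial_family.

Lemma weak_functional_continuous (K : numFieldType) (V : normedModType K)
  (phi : topological_dual V) : continuous (sval phi : weakTopology V -> K^o).
Proof. exact: (@sup_initial_continuous V (topological_dual V) K^o (fun phi => sval phi)). Qed.

Lemma linear_dominated_continuous (K : numFieldType) (V W : normedModType K)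
    (f : {linear V -> W}) (C : K) :
  C \is Num.real -> (forall x, `|f x| <= C * `|x|) -> continuous f.
Proof.
move=> Creal fC; apply/linear_bounded_continuous/linear_boundedP.
exists C; split => // r /ltW Cr x; apply: le_trans (fC x) _.
exact: ler_wpM2r.
Qed.

Section linfty_theory.
Variables (R : realType) (X : Type).
Implicit Types (f g : linfty R X).

Lemma linfty_eqP f g : (forall x, f x = g x) -> f = g.
Proof. by move=> fg; apply/val_inj/funext. Qed.

Lemma linfty_bound f : exists2 M : R, 0 <= M & forall x, normc (f x) <= M.
Proof.
have /bounded_functionsP[M fM] := linfty_bounded f.
by exists `|M| => // x; apply: le_trans (fM x) (ler_norm _).
Qed.

Lemma normc_le_norm f x : (normc (f x))%:C <= `|f|.
Proof. by rewrite lecR; exact: normc_le_linfty_norm. Qed.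

Lemma linfty_cvgP (T : Type) (F : set_system T) {FF : Filter F}
    (h : T -> linfty R X) f :
    (forall e : R, 0 < e -> \forall t \near F, forall x, normc (h t x - f x) <= e) ->
  h @ F --> f.
Proof.
move=> cv; apply/cvgrPdist_le => e; rewrite ltcE /= => /andP[/eqP e_im e0].
apply: filterS (cv _ e0) => t ht; rewrite distrC.
have -> : e = (complex.Re e)%:C by case: (e) e_im => a b /= ->.
by apply: linfty_norm_le; [exact: ltW|exact: ht].
Qed.

Lemma bounded_functional (phi : linfty R X -> R[i]^o) (C : R) :
    (forall a f g, phi (a *: f + g) = a * phi f + phi g) ->
    (forall f, `|phi f| <= C%:C * `|f|) ->
  exists psi : topological_dual (linfty R X), forall f, sval psi f = phi f.
Proof.
move=> lin phiC.
have lin' : linear_for *:%R phi by move=> a f g; exact: lin.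
pose L : {linear linfty R X -> R[i]^o} := HB.pack phi (GRing.isLinear.Build _ _ _ _ phi lin').
have cL : continuous (L : linfty R X -> R[i]^o).
  apply: (@linear_dominated_continuous _ _ _ L C%:C) => //.
  by apply/complex_realP; exists C.
by exists (exist _ L cL).
Qed.

Lemma evaluation_functional x :
  exists psi : topological_dual (linfty R X), forall f, sval psi f = f x.
Proof.
apply: (@bounded_functional (fun f => f x) 1) => // f.
by rewrite mul1r; exact: normc_le_norm.
Qed.

(** Bounded functions converge along an ultrafilter; uniqueness of limits makes the limit linear in
    [f], and the bound by twice the norm makes it continuous. *)
Lemma ultralimit_functional (F : set_system X) : UltraFilter F ->
  exists psi : topological_dual (linfty R X),
    forall f, (f : X -> R[i]^o) @ F --> (sval psi f : R[i]^o).
Proof.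
move=> FU.
have ex f : exists l : R[i]^o, (f : X -> R[i]^o) @ F --> l /\ `|l| <= 2%:R%:C * `|f|.
  have [l [fl lM]] := ultra_bounded_cvg FU (normc_le_linfty_norm f).
  exists l; split => //; rewrite -[`|f|]/(linfty_norm f) -rmorphM lecR.
  by rewrite mulr2n mulrDl mul1r.
have [L LP] := choice ex.
have [||psi psiP] := @bounded_functional L 2%:R.
- move=> a f g; have h1 := (LP (a *: f + g)).1.
  have h2 : ((a *: f + g) : X -> R[i]^o) @ F --> (a *: L f + L g : R[i]^o).
    by apply: cvgD; [apply: cvgZr; exact: (LP f).1|exact: (LP g).1].
  exact: (cvg_unique (@norm_hausdorff _ R[i]^o) h1 h2).
- by move=> f; exact: (LP f).2.
- by exists psi => f; rewrite psiP; exact: (LP f).1.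
Qed.

Lemma weak_linfty_hausdorff : hausdorff_space (weakTopology (linfty R X)).
Proof.
apply: (@sup_initial_hausdorff (linfty R X) _ R[i]^o) => [|f g fg].
  exact: norm_hausdorff.
apply: linfty_eqP => x; have [psi psiP] := evaluation_functional x.
by rewrite -!psiP; exact: fg.
Qed.

Lemma weak_precompact_sub (A C : set (linfty R X)) :
    A `<=` C -> @compact (weakTopology (linfty R X)) C ->
  @precompact (weakTopology (linfty R X)) A.
Proof.
move=> subC cC; apply: (@precompact_subset (weakTopology (linfty R X)) _ _ subC).
by apply: compact_precompact => //; exact: weak_linfty_hausdorff.
Qed.

(** The norm closure [C] of [A] is compact: finite nets force an ultrafilter on [C] to contain
    arbitrarily small balls, so its pointwise limit is a uniform one. Norm convergence then implies
    weak convergence. *)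
Lemma norm_totally_bounded_weak_precompact (A : set (linfty R X)) :
    (forall e : R, 0 < e -> exists s : seq (linfty R X), forall f, A f ->
       exists2 g, g \in s & forall x, normc (f x - g x) <= e) ->
  @precompact (weakTopology (linfty R X)) A.
Proof.
move=> Atb.
pose C := [set f | forall e : R, 0 < e ->
             exists2 g, A g & forall x, normc (f x - g x) <= e].
have subC : A `<=` C.
  by move=> f Af e e0; exists f => // x; rewrite subrr normc0 ltW.
apply: (weak_precompact_sub subC); rewrite compact_ultra => F FU FC.
have Cnet (e : R) : 0 < e -> exists g, F [set f | forall x, normc (f x - g x) <= e].
  move=> e0; have e20 : 0 < e / 2 by rewrite divr_gt0.
  have [s sP] := Atb _ e20.
  have [|g _ Fg] := @ultra_finite_cover _ (linfty R X) F
      (fun g => [set f | forall x, normc (f x - g x) <= e]) s FU; last by exists g.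
  apply: filterS FC => f /(_ _ e20)[h /sP[g gs hg] fh]; exists g => // x.
  rewrite -(subrKA (h x)) (le_trans (le_normcD _ _))// [leRHS]splitr.
  exact: lerD.
have [g0 Fg0] := Cnet 1 ltr01.
have [M0 _ g0M] := linfty_bound g0.
have cvx x : exists l : R[i]^o, (fun f : linfty R X => f x : R[i]^o) @ F --> l /\
    normc l <= (M0 + 1) + (M0 + 1).
  (* [ultra_bounded_cvg] asks for a bound on all of the space, while [f x] is bounded only on a
     member of [F]; the default [0] is taken off that member. *)
  pose h (f : linfty R X) : R[i]^o := if normc (f x) <= M0 + 1 then f x else 0.
  have M10 : 0 <= M0 + 1 by rewrite addr_ge0// (le_trans (normc_ge0 _) (g0M x)).
  have hM f : normc (h f) <= M0 + 1 by rewrite /h; case: ifPn => // _; rewrite normc0.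
  have [l [hl lM]] := ultra_bounded_cvg FU hM; exists l; split => //.
  move: hl => /complex_cvgP hl; apply/complex_cvgP => e e0.
  apply: filterS (filterI Fg0 (hl e e0)) => f [/(_ x) fg0].
  rewrite /h ifT// -(subrK (g0 x) (f x)) (le_trans (le_normcD _ _))// addrC.
  exact: lerD.
have [l lP] := choice cvx.
have lb : l \in @bounded_functions R X.
  by apply/bounded_functionsP; exists ((M0 + 1) + (M0 + 1)) => x; exact: (lP x).2.
pose L : linfty R X := Linfty lb.
have FL (e : R) : 0 < e -> F [set f | forall x, normc (f x - L x) <= e].
  move=> e0; have e30 : 0 < e / 3 by rewrite divr_gt0.
  have [g Fg] := Cnet _ e30.
  (* The bound does not depend on [x], although the [f] that mediates between [g x] and [L x]
     does. *)
  have Lg x : normc (g x - L x) <= e / 3 + e / 3.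
    have [/complex_cvgP/(_ _ e30) Fx _] := lP x.
    have [f [/(_ x) fg /ltW fl]] := filter_ex (filterI Fg Fx).
    rewrite -(subrKA (f x)) (le_trans (le_normcD _ _))// lerD//.
    by rewrite normcB.
  apply: filterS Fg => f fg x.
  rewrite -(subrKA (g x)) (le_trans (le_normcD _ _))//.
  rewrite (_ : e = e / 3 + (e / 3 + e / 3)); last by field.
  exact: lerD.
exists L; split.
  move=> e e0; have e20 : 0 < e / 2 by rewrite divr_gt0.
  have [f [fL /(_ _ e20)[g Ag fg]]] := filter_ex (filterI (FL _ e20) FC).
  exists g => // x.
  rewrite -(subrKA (f x)) (le_trans (le_normcD _ _))// [leRHS]splitr lerD//.
  by rewrite normcB.
apply/(@sup_initial_cvgP _ _ _ _ F _ L) => phi.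
have FLn : id @ F --> L by apply: linfty_cvgP.
exact: (cvg_comp _ _ FLn (svalP phi L)).
Qed.

End linfty_theory.

Section pullback.
Variables (R : realType) (X Y : Type) (j : Y -> X).

Lemma pullback_bounded (f : linfty R X) : (f \o j) \in @bounded_functions R Y.
Proof.
have /bounded_functionsP[M fM] := linfty_bounded f.
by apply/bounded_functionsP; exists M => y; exact: fM.
Qed.

Definition pullback (f : linfty R X) : linfty R Y := Linfty (pullback_bounded f).

Lemma norm_pullback (f : linfty R X) : `|pullback f| <= `|f|.
Proof.
apply: linfty_norm_le => [|y]; first exact: linfty_sup_ge0.
exact: (normc_le_linfty_norm f (j y)).
Qed.

(** Composing a continuous functional with this norm-decreasing linear map gives a continuous
    functional, whose weak continuity is known. *)
Lemma pullback_weak_continuous :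
  continuous (pullback : weakTopology (linfty R X) -> weakTopology (linfty R Y)).
Proof.
move=> f; apply/(@sup_initial_cvgP _ _ _ _ (pullback @ nbhs (f : weakTopology _))) => phi.
have lin : linear_for *:%R pullback by move=> a g h; apply: linfty_eqP.
pose P : {linear linfty R X -> linfty R Y} :=
  HB.pack pullback (GRing.isLinear.Build _ _ _ _ pullback lin).
have cP : continuous (P : linfty R X -> linfty R Y).
  apply: (@linear_dominated_continuous _ _ _ P 1) => // g.
  by rewrite mul1r; exact: norm_pullback.
pose Q : {linear linfty R X -> R[i]^o} := (sval phi \o P)%FUN.
have cQ : continuous (Q : linfty R X -> R[i]^o).
  by move=> g; apply: continuous_comp; [exact: cP|exact: (svalP phi)].
exact: (@weak_functional_continuous _ _ (exist _ Q cQ) f).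
Qed.

End pullback.

(** * The double limit argument *)

Lemma cluster_eventually_eq (T U : topologicalType) (F : set_system T) (f : T -> U) p c :
  hausdorff_space U -> continuous f -> F [set t | f t = c] -> cluster F p -> f p = c.
Proof.
move=> hU cf Fc Fp; apply: hU => A B /cf fA cB.
have [t [/= ftc fAt]] := Fp _ _ Fc fA.
by exists c; split; [rewrite -ftc|exact: nbhs_singleton cB].
Qed.

(** A form of dependent choice in which the next term may be constrained by all earlier ones, passed
    as a list. *)
Lemma dependent_sequence (T : Type) (Q : seq T -> T -> Prop) :
  (forall s, exists t, Q s t) -> exists u : nat -> T, forall n, Q (map u (iota 0 n)) (u n).
Proof.
move=> /choice[step stepQ].
pose build n := iter n (fun s => rcons s (step s)) [::].
exists (step \o build) => n; suff <- : build n = map (step \o build) (iota 0 n) by [].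
elim: n => // n IHn; by rewrite -addn1 iotaD map_cat /= add0n -IHn cats1 addn1.
Qed.

Section not_precompact.
Variable G : topologicalGroupType.

Definition two_sided_coverable (V : set G) :=
  exists s : seq (G * G), forall x, exists p u, [/\ p \in s, V u & x = (p.1 * u * p.2)%g].

Lemma two_sided_coverableS (U V : set G) :
  U `<=` V -> two_sided_coverable U -> two_sided_coverable V.
Proof.
move=> UV [s sP]; exists s => x; have [p [u [ps Uu ->]]] := sP x.
by exists p, u; split => //; exact: UV.
Qed.

Lemma separated_double_sequence (V : set G) :
    (forall u, V u -> V u^-1%g) -> ~ two_sided_coverable V ->
  exists g x : nat -> G, forall n m i j, (n <= m)%N -> (j < i)%N ->
    ~ V (g n * x m * (g i * x j)^-1)%g.
Proof.
move=> Vsym ncov.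
have avoid (s : seq (G * G)) : exists x, forall p u, p \in s -> V u -> x <> (p.1 * u * p.2)%g.
  apply: contrapT => /forallNP nex; apply: ncov; exists s => x.
  have /existsNP[p /existsNP[u /not_implyP[ps /not_implyP[Vu /contrapT ->]]]] := nex x.
  by exists p, u.
(* The pair [t] is the newest one. Its [g] is constrained against older pairs only; its [x], chosen
   afterwards, may also be multiplied by the new [g]. *)
pose Q (s : seq (G * G)) (t : G * G) :=
  (forall p q r, p \in s -> q \in s -> r \in s -> ~ V (t.1 * r.2 * (p.1 * q.2)^-1)%g) /\
  (forall p q r, p \in t :: s -> q \in t :: s -> r \in s -> ~ V (p.1 * t.2 * (q.1 * r.2)^-1)%g).
have [s|u uQ] := @dependent_sequence _ Q.
  (* [g x_r (g_p x_q)^-1] lies in [V] iff [g] lies in [V g_p x_q x_r^-1], and [g_p x (g_q x_r)^-1]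
     does iff [x] lies in [g_p^-1 V g_q x_r]. Each choice thus avoids finitely many two-sided
     translates of [V]. *)
  pose sA : seq (G * G) := [seq ((1 : G)%g, (pq * r.2^-1)%g) |
      pq <- [seq (p.1 * q.2)%g | p <- s, q <- s], r <- s].
  have [g gP] := avoid sA.
  pose sB : seq (G * G) := [seq (p^-1%g, qr) | p <- g :: map fst s,
      qr <- [seq (q * r.2)%g | q <- g :: map fst s, r <- s]].
  have [x xP] := avoid sB.
  have fst_in p : p \in (g, x) :: s -> p.1 \in g :: map fst s.
    by rewrite !inE => /predU1P[->|ps]; rewrite ?eqxx// (map_f fst ps) orbT.
  exists (g, x); split => [p q r ps qs rs|p q r /fst_in ps /fst_in qs rs] /=.
    have pqr : (1%g, (p.1 * q.2 * r.2^-1)%g) \in sA.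
      apply/allpairsPdep; exists (p.1 * q.2)%g, r; split => //=.
      by apply/allpairsPdep; exists p, q.
    move=> Vg; apply: (gP _ _ pqr Vg) => /=.
    by rewrite mul1g mulgA mulgVK mulgK.
  have pqr : (p.1^-1%g, (q.1 * r.2)%g) \in sB.
    apply/allpairsPdep; exists p.1, (q.1 * r.2)%g; split => //.
    by apply/allpairsPdep; exists q.1, r.
  move=> Vg; apply: (xP _ _ pqr Vg) => /=.
  by rewrite -!mulgA mulKg mulVg mulg1.
exists (fst \o u), (snd \o u) => n m i j nm ji /=.
have in_u a b : (a < b)%N -> u a \in map u (iota 0 b).
  by move=> ab; apply: map_f; rewrite mem_iota.
have in_uS a b : (a <= b)%N -> u a \in u b :: map u (iota 0 b).
  by rewrite leq_eqVlt inE => /predU1P[->|/in_u ->]; rewrite ?eqxx ?orbT.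
(* The constraint was imposed when the pair of largest index, [m] or [i], was chosen. In the second
   case the quotient is reversed, and symmetry of [V] is used. *)
have [im|mi] := leqP i m.
  have [_ /(_ (u n) (u i) (u j))] := uQ m.
  by apply; rewrite ?in_uS ?in_u//; exact: leq_trans ji im.
have [/(_ (u n) (u m) (u j)) uQi _] := uQ i.
move=> /Vsym; rewrite invgF; apply: uQi; rewrite ?in_u//; exact: leq_ltn_trans nm mi.
Qed.

(* A weak cluster point [phi] of the translates [f (g_n _)] is [1] at each [x_m]; the
   limit along an ultrafilter in [m] is a continuous functional, equal to [0] at each
   translate but to [1] at [phi]. *)
Lemma wap_double_limit (R : realType) (f : G -> R[i]^o) (g x : nat -> G) :
    weakly_almost_periodic (@left_translation G) f ->
    (forall n m, (n <= m)%N -> f (g n * x m)%g = 0) ->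
    (forall n m, (m < n)%N -> f (g n * x m)%g = 1) ->
  False.
Proof.
move=> [F Ff wap] f0 f1.
pose T n : linfty R G := translate (@left_translation G) (g n)^-1%g F.
have TE n y : T n y = f (g n * y)%g by rewrite /T /= Ff invgK.
have TO n : orbit_of (@left_translation G) F (T n) by exists (g n)^-1%g.
rewrite precompactE in wap.
have [|phi [_ phiT]] := wap (T @ \oo) _.
  apply: (@filterE _ (nbhs \oo)) => n.
  exact: (@subset_closure (weakTopology (linfty R G)) _ _ (TO n)).
have hC : hausdorff_space R[i]^o := @norm_hausdorff _ R[i]^o.
have phi_x m : phi (x m) = 1.
  have [psi psiE] := @evaluation_functional R G (x m); rewrite -psiE.
  apply: (cluster_eventually_eq hC (@weak_functional_continuous _ _ psi) _ phiT).
  by exists m.+1 => // n mn; exact: etrans (psiE (T n)) (etrans (TE n (x m)) (f1 _ _ mn)).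
have [U [UU ooU]] := @ultraFilterLemma _ (nbhs \oo : set_system nat) _.
have [psi psiE] := @ultralimit_functional R G (x @ U) (ultra_map x UU).
have psi_phi0 : sval psi phi = 0.
  apply: (cluster_eventually_eq hC (@weak_functional_continuous _ _ psi) _ phiT).
  apply: (@filterE _ (nbhs \oo)) => n /=.
  apply: (cvg_unique hC (psiE (T n))).
  apply: cvg_near_cst; apply: ooU; exists n => // m /= nm.
  exact: etrans (TE n (x m)) (f0 _ _ nm).
have : sval psi phi = 1.
  apply: (cvg_unique hC (psiE phi)); apply: cvg_near_cst.
  by apply: (@filterE _ U) => m /=; rewrite phi_x.
by rewrite psi_phi0 => /esym/eqP; rewrite oner_eq0.
Qed.

Lemma wap_totally_bounded (R : realType) :
    (forall f : G -> R[i]^o, bounded_fun f -> right_uniformly_continuous f ->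
       weakly_almost_periodic (@left_translation G) f) ->
  totally_bounded_group G.
Proof.
move=> wap; apply: two_sided_totally_bounded => V V1.
(* [separated_double_sequence] needs a symmetric set. *)
pose W := V `&` [set u | V u^-1%g].
have W1 : nbhs 1%g W by apply: filterI => //; exact: nbhs1_inv.
have Wsym u : W u -> W u^-1%g by move=> [Vu Vu1]; split => //=; rewrite invgK.
apply: (@two_sided_coverableS W); first by move=> u [].
apply: contrapT => /(separated_double_sequence Wsym)[g [x gx]].
pose A := [set y | exists n m, (n <= m)%N /\ y = (g n * x m)%g].
pose B := [set y | exists n m, (m < n)%N /\ y = (g n * x m)%g].
have AB a b : A a -> B b -> ~ W (a * b^-1)%g.
  by move=> [n [m [nm ->]]] [i [j [ij ->]]]; exact: gx.
have [f [f01 fA fB fruc]] := @right_uniform_urysohn R G A B W W1 AB.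
pose h y : R[i]^o := (f y)%:C.
have h_ruc (e : R) : 0 < e -> exists2 U : set G, nbhs 1%g U &
    forall y z, U (y * z^-1)%g -> normc (h z - h y) < e.
  move=> /fruc[U U1 fU]; exists U => // y z /fU fyz.
  by rewrite /h -rmorphB normc_real distrC.
apply: (@wap_double_limit R h g x).
- have h_bnd : h \in @bounded_functions R G.
    apply/bounded_functionsP; exists 1 => y; rewrite normc_real.
    by have /andP[f0 f1] := f01 y; rewrite ger0_norm.
  rewrite /bounded_functions inE in h_bnd; apply: wap => //; split.
  + move=> y; apply/complex_cvgP => e /h_ruc[U U1 hU].
    have := nbhs1_right y (nbhs1_inv U1); apply: filterS => z /=.
    by rewrite invgM invgK => /hU; rewrite normcB.
  + move=> e /h_ruc[U U1 hU]; exists U => // y z /hU.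
    by rewrite -[`|_|]/((normc (h z - h y))%:C) ltcR.
- by move=> n m nm; rewrite /h fA//; exists n, m.
- by move=> n m nm; rewrite /h fB//; exists n, m.
Qed.

End not_precompact.

(** * The compact completion for bi-invariant pseudometrics *)

(** Continuous, totally bounded, bi-invariant pseudometrics. Continuity at [1] is enough because
    invariance transports it; the bound [1] will confine all coordinates of the completion to a
    compact interval. *)
Record ap_metric (R : realType) (G : topologicalGroupType) := APMetric {
  ap_dist :> G -> G -> R ;
  ap_refl : forall x, ap_dist x x = 0 ;
  ap_sym : forall x y, ap_dist x y = ap_dist y x ;
  ap_tri : forall y x z, ap_dist x z <= ap_dist x y + ap_dist y z ;
  ap_le1 : forall x y, ap_dist x y <= 1 ;
  ap_mull : forall a x y, ap_dist (a * x)%g (a * y)%g = ap_dist x y ;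
  ap_mulr : forall a x y, ap_dist (x * a)%g (y * a)%g = ap_dist x y ;
  ap_nbhs : forall e, 0 < e -> nbhs 1%g [set u | ap_dist u 1%g < e] ;
  ap_net : forall e, 0 < e ->
    exists s : seq G, forall x, exists2 a, a \in s & ap_dist a x < e
}.

Section katetov.
Variables (R : realType) (G : topologicalGroupType).
Implicit Types (d : ap_metric R G) (phi psi chi : G -> R).

(* These are exactly the functions [d(p, _)] for [p] in the completion of [(G, d)]. *)
Record katetov d phi : Prop := Katetov {
  kat_lip : forall a b, phi a <= d a b + phi b ;
  kat_ge : forall a b, d a b <= phi a + phi b ;
  kat_inf : forall e, 0 < e -> exists a, phi a < e
}.

Lemma ap_inv d x y : d x^-1%g y^-1%g = d x y.
Proof.
rewrite -(ap_mulr d x) mulVg -(ap_mull d y) mulg1 mulVKg.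
exact: ap_sym.
Qed.

Lemma kat_ge0 d phi a : katetov d phi -> 0 <= phi a.
Proof. by move=> k; have := kat_ge k a a; rewrite ap_refl; lra. Qed.

Lemma kat_le1 d phi a : katetov d phi -> phi a <= 1.
Proof.
move=> k; apply/ler_addgt0Pr => e e0; have [b be] := kat_inf k e0.
by have := kat_lip k a b; have := ap_le1 d a b; lra.
Qed.

Lemma katetov_point d x : katetov d (d x).
Proof.
split=> [a b|a b|e e0].
- by rewrite addrC (ap_sym d a b); exact: ap_tri.
- by rewrite (ap_sym d x a); exact: ap_tri.
- by exists x; rewrite ap_refl.
Qed.

Lemma katetov_inv d phi : katetov d phi -> katetov d (fun h => phi h^-1%g).
Proof.
move=> k; split=> [a b|a b|e /(kat_inf k)[a ae]].
- by rewrite -(ap_inv d a); exact: kat_lip.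
- by rewrite -(ap_inv d a); exact: kat_ge.
- by exists a^-1%g; rewrite invgK.
Qed.

(* As [G] is dense, [d(p q, h) = inf_k (d(p, k) + d(k q, h))], and [d(k q, h) = d(q, k^-1 h)]. *)
Definition infconv phi psi h := inf (range (fun k => phi k + psi (k^-1 * h)%g)).

Lemma infconv_le d phi psi h k : katetov d phi -> katetov d psi ->
  infconv phi psi h <= phi k + psi (k^-1 * h)%g.
Proof.
move=> kp kq; apply: ge_inf; last by exists k.
by exists 0 => _ [l _ <-]; apply: addr_ge0; [exact: kat_ge0 kp|exact: kat_ge0 kq].
Qed.

Lemma infconv_ge phi psi h c :
  (forall k, c <= phi k + psi (k^-1 * h)%g) -> c <= infconv phi psi h.
Proof.
move=> ck; apply: lb_le_inf; first by exists (phi 1%g + psi (1^-1 * h)%g), 1%g.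
by move=> _ [k _ <-].
Qed.

Lemma katetov_infconv d phi psi :
  katetov d phi -> katetov d psi -> katetov d (infconv phi psi).
Proof.
move=> kp kq; split=> [a b|a b|e e0].
- rewrite addrC -lerBlDr; apply: infconv_ge => k; rewrite lerBlDr.
  apply: le_trans (infconv_le a k kp kq) _.
  by have := kat_lip kq (k^-1 * a)%g (k^-1 * b)%g; rewrite ap_mull; lra.
- rewrite -lerBlDr; apply: infconv_ge => k; rewrite lerBlDr addrC -lerBlDr.
  apply: infconv_ge => l; rewrite lerBlDr.
  have h1 := kat_ge kp k l; have h2 := kat_ge kq (k^-1 * a)%g (l^-1 * b)%g.
  (* The detour through [l k^-1 a] splits [d a b] into [d k l], by right invariance, and
     [d (k^-1 a) (l^-1 b)], by left invariance. *)
  have h3 := ap_tri d (l * (k^-1 * a))%g a b.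
  have h4 : d a (l * (k^-1 * a))%g = d k l.
    by rewrite -(ap_mulr d (k^-1 * a)%g k) mulVKg.
  have h5 : d (l * (k^-1 * a))%g b = d (k^-1 * a)%g (l^-1 * b)%g.
    by rewrite -(ap_mull d l (k^-1 * a)%g) mulVKg.
  by lra.
- have e20 : 0 < e / 2 by rewrite divr_gt0.
  have [k ke] := kat_inf kp e20; have [l le] := kat_inf kq e20.
  exists (k * l)%g; apply: le_lt_trans (infconv_le _ k kp kq) _.
  by rewrite mulKg; lra.
Qed.

Lemma infconv_point d x y : infconv (d x) (d y) = d (x * y)%g.
Proof.
apply/funext => h; apply/eqP; rewrite eq_le; apply/andP; split.
  have := infconv_le h x (katetov_point d x) (katetov_point d y).
  by rewrite ap_refl add0r -(ap_mull d x y) mulVKg.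
apply: infconv_ge => k; apply: le_trans (ap_tri d (k * y)%g _ _) _.
by rewrite ap_mulr lerD2l -{1}(mulVKg k h) ap_mull.
Qed.

Lemma infconv1l d phi : katetov d phi -> infconv (d 1%g) phi = phi.
Proof.
move=> k; apply/funext => h; apply/eqP; rewrite eq_le; apply/andP; split.
  have := infconv_le h 1%g (katetov_point d 1%g) k.
  by rewrite ap_refl add0r invg1 mul1g.
apply: infconv_ge => l; have := kat_lip k h (l^-1 * h)%g.
by rewrite -{2}(mul1g h) ap_mulr -(ap_inv d 1%g) invgK invg1.
Qed.

Lemma infconv1r d phi : katetov d phi -> infconv phi (d 1%g) = phi.
Proof.
move=> k; apply/funext => h; apply/eqP; rewrite eq_le; apply/andP; split.
  by have := infconv_le h h k (katetov_point d 1%g); rewrite mulVg ap_refl addr0.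
apply: infconv_ge => l; have := kat_lip k h l.
by rewrite -(ap_mull d l 1%g) mulg1 mulVKg addrC (ap_sym d h).
Qed.

(** Both sides are infima of the same triple sums, after the substitution of [l k] for the splitting
    point. *)
Lemma infconvA d phi psi chi : katetov d phi -> katetov d psi -> katetov d chi ->
  infconv phi (infconv psi chi) = infconv (infconv phi psi) chi.
Proof.
move=> kp kq kr; have kpq := katetov_infconv kp kq; have kqr := katetov_infconv kq kr.
apply/funext => h; apply/eqP; rewrite eq_le; apply/andP; split.
  apply: infconv_ge => k; rewrite -lerBlDr; apply: infconv_ge => l; rewrite lerBlDr.
  apply: le_trans (infconv_le h l kp kqr) _; rewrite -addrA lerD2l.
  apply: le_trans (infconv_le _ (l^-1 * k)%g kq kr) _.
  by rewrite invgM invgK -mulgA mulVKg.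
apply: infconv_ge => k; rewrite addrC -lerBlDr; apply: infconv_ge => l.
rewrite lerBlDr; apply: le_trans (infconv_le h (k * l)%g kpq kr) _.
have := infconv_le (k * l)%g k kp kq; rewrite mulKg => kl.
by rewrite invgM -mulgA; lra.
Qed.

Lemma infconvVl d phi : katetov d phi -> infconv (fun h => phi h^-1%g) phi = d 1%g.
Proof.
move=> k; apply/funext => h; apply/eqP; rewrite eq_le; apply/andP; split.
  apply/ler_addgt0Pr => e e0; have e20 : 0 < e / 2 by rewrite divr_gt0.
  (* A point [l] of [G] within [e / 2] of the point coded by [phi] stands in for it; its inverse is
     the splitting point. *)
  have [l le] := kat_inf k e20.
  have := infconv_le h l^-1%g (katetov_inv k) k; rewrite invgK.
  have lh x : d x (x * h)%g = d 1%g h by rewrite -{1}(mulg1 x) ap_mull.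
  by have := kat_lip k (l * h)%g l; rewrite ap_sym lh; lra.
apply: infconv_ge => l; have := kat_ge k l^-1%g (l^-1 * h)%g.
by rewrite -{1}(mulg1 l^-1%g) ap_mull.
Qed.

Lemma infconvVr d phi : katetov d phi -> infconv phi (fun h => phi h^-1%g) = d 1%g.
Proof.
move=> k; have := infconvVl (katetov_inv k).
by under [X in infconv X _]funext do rewrite invgK.
Qed.

End katetov.

(** * The product of the completions as a compact group *)

Section compact_group.
Variables (R : realType) (G : topologicalGroupType).

Definition katetov_family (phi : ap_metric R G -> G -> R) : Prop :=
  forall d, katetov d (phi d).

(** The product over all [d] of the completions of [(G, d)], a point of each factor being coded by
    its distance function. *)
Definition ap_completion : Type := {phi | katetov_family phi}.
Local Notation K := ap_completion.

HB.instance Definition _ := gen_eqMixin K.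
HB.instance Definition _ := gen_choiceMixin K.

Let coordinate (p : ap_metric R G * G) (k : K) : R := sval k p.1 p.2.

HB.instance Definition _ := Topological.copy K
  (sup_topology (fun p => Topological.on (initial_topology (coordinate p)))).

Lemma ap_completion_eqP (k l : K) : (forall d, sval k d = sval l d) -> k = l.
Proof. case: k l => [k hk] [l hl] kl; apply: eq_exist; exact/functional_extensionality_dep. Qed.

Lemma ap_completion_cvgP (F : set_system K) {FF : Filter F} (k : K) :
  F --> k <-> forall d x, (fun l : K => sval l d x) @ F --> sval k d x.
Proof.
have [Fk kF] := @sup_initial_cvgP _ _ _ coordinate F FF k.
split=> [Fk' d x|cv]; first exact: (Fk Fk' (d, x)).
by apply: kF; case=> d x; exact: cv.
Qed.

Lemma coordinate_continuous d x : continuous (fun l : K => sval l d x).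
Proof. exact: (@sup_initial_continuous _ _ _ coordinate (d, x)). Qed.

Definition ap_point (x : G) : K :=
  exist katetov_family (fun d : ap_metric R G => d x : G -> R) (fun d => katetov_point d x).

Definition ap_mul (k l : K) : K :=
  exist katetov_family (fun d => infconv (sval k d) (sval l d))
    (fun d => katetov_infconv (svalP k d) (svalP l d)).

Definition ap_invg (k : K) : K :=
  exist katetov_family (fun d => fun h => sval k d h^-1%g) (fun d => katetov_inv (svalP k d)).

Let mulA : associative ap_mul.
Proof.
move=> k l m; apply: ap_completion_eqP => d.
exact: infconvA (svalP k d) (svalP l d) (svalP m d).
Qed.

Let mul1 : left_id (ap_point 1%g) ap_mul.
Proof. by move=> k; apply: ap_completion_eqP => d; exact: infconv1l (svalP k d). Qed.

Let mulr1 : right_id (ap_point 1%g) ap_mul.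
Proof. by move=> k; apply: ap_completion_eqP => d; exact: infconv1r (svalP k d). Qed.

Let mulV : left_inverse (ap_point 1%g) ap_invg ap_mul.
Proof. by move=> k; apply: ap_completion_eqP => d; exact: infconvVl (svalP k d). Qed.

Let mulrV : right_inverse (ap_point 1%g) ap_invg ap_mul.
Proof. by move=> k; apply: ap_completion_eqP => d; exact: infconvVr (svalP k d). Qed.

HB.instance Definition _ := isGroup.Build K mulA mul1 mulr1 mulV mulrV.

Lemma ap_pointM : {morph ap_point : x y / (x * y)%g}.
Proof. by move=> x y; apply: ap_completion_eqP => d; rewrite /= infconv_point. Qed.

(** By [kat_lip] the coded functions are 1-Lipschitz, so closeness on a finite [e / 3]-net is
    closeness everywhere. Joint continuity of multiplication rests on this uniformity. *)
Lemma ap_completion_near (k : K) d (e : R) : 0 < e ->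
  \forall l \near k, forall x, `|sval l d x - sval k d x| <= e.
Proof.
move=> e0; have e30 : 0 < e / 3 by rewrite divr_gt0.
have [s sP] := ap_net d e30.
have : \forall l \near k, forall a, a \in s -> `|sval l d a - sval k d a| < e / 3.
  elim: s {sP} => [|a s IHs]; first by apply: (@filterE _ _ (nbhs_filter k)) => l a [].
  have ca : nbhs k [set l : K | `|sval l d a - sval k d a| < e / 3].
    have := @coordinate_continuous d a k (ball (sval k d a) (e / 3)) (nbhsx_ballx _ _ e30).
    by apply: (@filterS _ _ (nbhs_filter k)) => l; rewrite /ball /= distrC.
  apply: (@filterS _ _ (nbhs_filter k) _ _ _ (@filterI _ _ (nbhs_filter k) _ _ ca IHs)).
  by move=> l [la ls] b; rewrite inE => /predU1P[->|/ls].
apply: filterS => l ls x; have [a /ls la ax] := sP x.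
have h1 := kat_lip (svalP k d) a x; have h2 := kat_lip (svalP k d) x a.
have h3 := kat_lip (svalP l d) a x; have h4 := kat_lip (svalP l d) x a.
rewrite (ap_sym d x a) in h2 h4.
by move: la; rewrite ltr_norml ler_norml => /andP[? ?]; apply/andP; split; lra.
Qed.

Lemma infconv_near d phi psi phi' psi' (e : R) (h : G) :
    katetov d phi -> katetov d psi -> katetov d phi' -> katetov d psi' ->
    (forall x, `|phi' x - phi x| <= e) -> (forall x, `|psi' x - psi x| <= e) ->
  infconv phi psi h <= infconv phi' psi' h + (e + e).
Proof.
move=> kp kq kp' kq' pe qe; rewrite -lerBlDr; apply: infconv_ge => k; rewrite lerBlDr.
apply: le_trans (infconv_le h k kp kq) _.
have /ler_normlP[h1 _] := pe k; have /ler_normlP[h2 _] := qe (k^-1 * h)%g.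
by lra.
Qed.

Let mul_cont : continuous (fun p : K * K => (p.1 * p.2)%g).
Proof.
move=> [k l]; apply/ap_completion_cvgP => d h; apply/cvgrPdist_le => e e0.
have e20 : 0 < e / 2 by rewrite divr_gt0.
exists ([set k' | forall x, `|sval k' d x - sval k d x| <= e / 2],
        [set l' | forall x, `|sval l' d x - sval l d x| <= e / 2]).
  by split; exact: ap_completion_near.
move=> [k' l'] [/= kk' ll'].
have k'k x : `|sval k d x - sval k' d x| <= e / 2 by rewrite distrC.
have l'l x : `|sval l d x - sval l' d x| <= e / 2 by rewrite distrC.
have h1 := infconv_near h (svalP k d) (svalP l d) (svalP k' d) (svalP l' d) kk' ll'.
have h2 := infconv_near h (svalP k' d) (svalP l' d) (svalP k d) (svalP l d) k'k l'l.
by rewrite ler_norml; apply/andP; split; lra.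
Qed.

Let inv_cont : continuous (fun k : K => k^-1%g).
Proof.
move=> k; apply/(@ap_completion_cvgP _ (fmap_filter _ (nbhs_filter k))) => d h.
exact: (@coordinate_continuous d h^-1%g k).
Qed.

HB.instance Definition _ := isTopologicalGroup.Build K mul_cont inv_cont.

Lemma ap_completion_hausdorff : hausdorff_space K.
Proof.
apply: (@sup_initial_hausdorff _ _ R coordinate) => [|k l kl]; first exact: Rhausdorff.
by apply: ap_completion_eqP => d; apply/funext => x; exact: (kl (d, x)).
Qed.

Lemma ap_completion_compact : compact [set: K].
Proof.
rewrite compact_ultra => U UU _.
have coord d x : exists r : R, (fun k : K => sval k d x) @ U --> r.
  have := @segment_compact R 0 1; rewrite compact_ultra.
  move=> /(_ _ (ultra_map (fun k : K => sval k d x) UU))[|r [_ Ur]]; last by exists r.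
  apply: (@filterE _ U) => k /=; rewrite in_itv /=.
  by rewrite (kat_ge0 x (svalP k d)) (kat_le1 x (svalP k d)).
have /choice[phi phiP] : forall p : ap_metric R G * G, exists r : R,
    (fun k : K => sval k p.1 p.2) @ U --> r by move=> [d x]; exact: coord.
have phi_near d x (e : R) : 0 < e -> U [set k | `|phi (d, x) - sval k d x| < e].
  by move=> e0; have /cvgrPdist_lt/(_ e e0) := phiP (d, x).
have kphi d : katetov d (fun x => phi (d, x)).
  split=> [a b|a b|e e0].
  - apply/ler_addgt0Pr => e e0; have e20 : 0 < e / 2 by rewrite divr_gt0.
    have [k [/= ka kb]] := filter_ex (filterI (phi_near d a _ e20) (phi_near d b _ e20)).
    have := kat_lip (svalP k d) a b; move: ka kb; rewrite !ltr_norml.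
    by move=> /andP[? ?] /andP[? ?]; lra.
  - apply/ler_addgt0Pr => e e0; have e20 : 0 < e / 2 by rewrite divr_gt0.
    have [k [/= ka kb]] := filter_ex (filterI (phi_near d a _ e20) (phi_near d b _ e20)).
    have := kat_ge (svalP k d) a b; move: ka kb; rewrite !ltr_norml.
    by move=> /andP[? ?] /andP[? ?]; lra.
  - have e30 : 0 < e / 3 by rewrite divr_gt0.
    have [s sP] := ap_net d e30.
    (* An infimum condition need not survive pointwise limits; the finite net yields a single [a]
       that works for all [k] in a member of [U]. *)
    pose A a : set K := [set k | sval k d a < e / 3 + e / 3].
    have [|a _ Ua] := @ultra_finite_cover _ _ U A s UU.
      apply: (@filterE _ U) => k; have [g ge] := kat_inf (svalP k d) e30.
      have [a as_ ag] := sP g; exists a; rewrite // /A /=.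
      by have := kat_lip (svalP k d) a g; lra.
    exists a; have [k []] := filter_ex (filterI Ua (phi_near d a _ e30)).
    by rewrite /A /= => ka; rewrite ltr_norml => /andP[? ?]; lra.
exists (exist katetov_family (fun d x => phi (d, x)) kphi); split => //.
by apply/ap_completion_cvgP => d x; exact: (phiP (d, x)).
Qed.

Lemma ap_point_continuous : continuous ap_point.
Proof.
move=> x; apply/ap_completion_cvgP => d h; apply/cvgrPdist_lt => e e0.
have ne := ap_nbhs d e0.
have : nbhs x [set y | d (y * x^-1)%g 1%g < e].
  by apply: (@mulgr_continuous G x^-1%g x [set u | d u 1%g < e]); rewrite mulgV.
apply: filterS => y /=; rewrite -(ap_mulr d x) mulgVK mul1g => yx.
have h1 := ap_tri d x y h; have h2 := ap_tri d y x h.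
rewrite (ap_sym d x y) in h2.
by rewrite ltr_norml; apply/andP; split; lra.
Qed.

(** The balls of the pseudometrics form a base at [1]. With the Hausdorff axiom this makes
    [ap_point] injective, and its inverse is continuous since being [d]-close to [x] is a condition
    on one coordinate. *)
Lemma ap_separated_precompact : hausdorff_space G ->
    (forall V : set G, nbhs 1%g V -> exists (d : ap_metric R G) (r : R),
       0 < r /\ forall u, d u 1%g < r -> V u) ->
  precompact_group G.
Proof.
move=> hG sep; exists K, (range ap_point).
have inj : injective ap_point.
  move=> x y xy; apply: hG => A B xA yB.
  have /sep[d [r [r0 dA]]] : nbhs 1%g [set u | A (u * x)%g].
    by apply: (@mulgr_continuous G x 1%g A); rewrite mul1g.
  exists y; split; last exact: nbhs_singleton.
  rewrite -(mulgVK x y); apply: (dA (y * x^-1)%g).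
  rewrite -(ap_mulr d x) mulgVK mul1g.
  have <- : sval (ap_point x) d x = d y x by rewrite xy.
  by rewrite /= ap_refl.
split.
- exact: ap_completion_hausdorff.
- exact: ap_completion_compact.
- split; first by apply/mem_set; exists 1%g.
  move=> _ _ /set_mem[x _ <-] /set_mem[y _ <-]; apply/mem_set.
  exists (x * y^-1)%g => //; rewrite ap_pointM; congr (_ * _)%g.
  by apply: (mulIg (ap_point y)); rewrite -ap_pointM !mulVg.
have inr x : ap_point x \in range ap_point by apply/mem_set; exists x.
pose phi x : range ap_point := exist _ (ap_point x) (inr x).
have /choice[psi psiP] : forall h : range ap_point, exists x, ap_point x = set_val h.
  by move=> [k kr]; have [x _ xk] := set_mem kr; exists x.
have phiK : cancel phi psi by move=> x; apply: inj; rewrite psiP.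
have psiK : cancel psi phi by move=> h; apply: val_inj; exact: psiP.
exists phi, psi; split => //.
- by move=> x y; exact: ap_pointM.
- by apply: continuous_comp_initial; exact: ap_point_continuous.
move=> h; have [x ->] : exists x, h = phi x by exists (psi h); rewrite psiK.
move=> V; rewrite phiK => xV.
have /sep[d [r [r0 dV]]] : nbhs 1%g [set u | V (u * x)%g].
  by apply: (@mulgr_continuous G x 1%g V); rewrite mul1g.
have : nbhs (ap_point x) [set k | sval k d x < r].
  have := @coordinate_continuous d x (ap_point x) [set t | t < r]; apply.
  by rewrite /= ap_refl; exact: lt_nbhsl.
move=> /(@initial_continuous _ _ (set_val : range ap_point -> K) (phi x)).
apply: (@filterS _ _ (nbhs_filter (phi x))) => l /=.
rewrite -psiP /= => lx; rewrite -(mulgVK x (psi l)).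
by apply: dV; rewrite -(ap_mulr d x) mulgVK mul1g.
Qed.

End compact_group.

(** * Bi-invariant pseudometrics on totally bounded groups *)

Section totally_bounded_groups.
Variables (R : realType) (G : topologicalGroupType).
Hypothesis tbG : totally_bounded_group G.

(** Finitely many conjugations suffice: [a = p f^-1] with [f] in a finite set and [p] small, so
    [a w a^-1 = p (f^-1 w f) p^-1]. *)
Lemma totally_bounded_small_invariant (U : set G) : nbhs 1%g U ->
  nbhs 1%g [set w | forall a, U (a * w * a^-1)%g].
Proof.
move=> /nbhs1_div[U1 U11 U1U]; have [U2 U21 U2U1] := nbhs1_mul U11.
have [F FP] := tbG (nbhs1_inv (filterI U11 U21)).
have : nbhs 1%g [set w | forall f, f \in F -> U2 (f^-1 * w * f)%g].
  elim: F {FP} => [|f F IHF]; first by apply: (@filterE _ _ (nbhs_filter (1%g : G))).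
  have := nbhs1_conj f^-1%g U21; rewrite invgK => U2f.
  by apply: filterS (filterI U2f IHF) => w [wf wF] g; rewrite inE => /predU1P[->|/wF].
apply: filterS => w wF a; have [f fF [/= p1 p2]] := FP a^-1%g.
set p := (f^-1 * a^-1)^-1%g in p1 p2.
have -> : a = (p * f^-1)%g by rewrite /p invgM !invgK mulgK.
rewrite invgM invgK -mulgA mulgA -(mulgA p) mulgA -mulgA.
have /(U2U1 _ _ p2) := wF f fF.
by move=> /U1U /(_ p1); congr U; rewrite !mulgA.
Qed.

Section sup_metric.
Variable f : G -> R.
Hypothesis f01 : forall x, 0 <= f x <= 1.
Hypothesis f_ruc : forall r, 0 < r -> exists2 W : set G, nbhs 1%g W &
  forall x y, W (x * y^-1)%g -> `|f x - f y| < r.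

Let D x y : set R := range (fun p : G * G => `|f (p.1 * x * p.2)%g - f (p.1 * y * p.2)%g|).

(** Taking all two-sided translates of [f] makes the pseudometric bi-invariant. *)
Definition sup_dist x y : R := sup (D x y).

Lemma sup_dist_ge x y a b : `|f (a * x * b)%g - f (a * y * b)%g| <= sup_dist x y.
Proof.
apply: ub_le_sup; last by exists (a, b).
exists 1 => _ [[c d] _ <-] /=.
have := f01 (c * x * d)%g; have := f01 (c * y * d)%g.
by move=> /andP[? ?] /andP[? ?]; rewrite ler_norml; apply/andP; split; lra.
Qed.

Lemma sup_dist_le x y c :
  (forall a b, `|f (a * x * b)%g - f (a * y * b)%g| <= c) -> sup_dist x y <= c.
Proof.
move=> xyc; apply: ge_sup; first by exists `|f (1 * x * 1)%g - f (1 * y * 1)%g|, (1%g, 1%g).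
by move=> _ [[a b] _ <-]; exact: xyc.
Qed.

(** Since [(a x b) (a y b)^-1 = a (x y^-1) a^-1], the factor [b] disappears and a neighbourhood
    small under all conjugations absorbs [a]. *)
Lemma sup_dist_small e : 0 < e -> exists2 W : set G, nbhs 1%g W &
  forall x y, W (x * y^-1)%g -> sup_dist x y < e.
Proof.
move=> e0; have e20 : 0 < e / 2 by rewrite divr_gt0.
have [W W1 fW] := f_ruc e20.
exists [set w | forall a, W (a * w * a^-1)%g]; first exact: totally_bounded_small_invariant.
move=> x y xy; apply: (@le_lt_trans _ _ (e / 2)); last by rewrite ltr_pdivrMr// ltr_pMr// ltr1n.
apply: sup_dist_le => a b; apply/ltW/fW.
by have := xy a; rewrite !invgM !mulgA mulgK.
Qed.

Lemma sup_dist_refl x : sup_dist x x = 0.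
Proof.
apply/eqP; rewrite eq_le; apply/andP; split.
  by apply: sup_dist_le => a b; rewrite subrr normr0.
by apply: le_trans (sup_dist_ge x x 1%g 1%g).
Qed.

Lemma sup_dist_sym x y : sup_dist x y = sup_dist y x.
Proof.
by apply/eqP; rewrite eq_le; apply/andP; split; apply: sup_dist_le => a b;
  rewrite distrC; exact: sup_dist_ge.
Qed.

Lemma sup_dist_tri y x z : sup_dist x z <= sup_dist x y + sup_dist y z.
Proof.
apply: sup_dist_le => a b.
by apply: le_trans (ler_distD (f (a * y * b)%g) _ _) _; apply: lerD; exact: sup_dist_ge.
Qed.

Lemma sup_dist_le1 x y : sup_dist x y <= 1.
Proof.
apply: sup_dist_le => a b.
have := f01 (a * x * b)%g; have := f01 (a * y * b)%g.
by move=> /andP[? ?] /andP[? ?]; rewrite ler_norml; apply/andP; split; lra.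
Qed.

Lemma sup_dist_mull a x y : sup_dist (a * x)%g (a * y)%g = sup_dist x y.
Proof.
apply/eqP; rewrite eq_le; apply/andP; split; apply: sup_dist_le => b c.
  by rewrite !mulgA; exact: sup_dist_ge.
by have := sup_dist_ge (a * x)%g (a * y)%g (b * a^-1)%g c; rewrite !mulgA !mulgVK.
Qed.

Lemma sup_dist_mulr a x y : sup_dist (x * a)%g (y * a)%g = sup_dist x y.
Proof.
apply/eqP; rewrite eq_le; apply/andP; split; apply: sup_dist_le => b c.
  by rewrite !mulgA -!(mulgA _ a c); exact: sup_dist_ge.
by have := sup_dist_ge (x * a)%g (y * a)%g b (a^-1 * c)%g; rewrite !mulgA !mulgK.
Qed.

Lemma sup_dist_nbhs e : 0 < e -> nbhs 1%g [set u | sup_dist u 1%g < e].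
Proof.
move=> /sup_dist_small[W W1 We]; apply: filterS W1 => u Wu /=.
by apply: We; rewrite invg1 mulg1.
Qed.

Lemma sup_dist_net e : 0 < e ->
  exists s : seq G, forall x, exists2 a, a \in s & sup_dist a x < e.
Proof.
move=> /sup_dist_small[W W1 We]; have [F FP] := tbG W1.
(* Total boundedness controls [a^-1 x] but [sup_dist] is controlled by [x y^-1], so the cover is
   applied to [x^-1] and its centres are inverted. *)
exists (map (fun a => a^-1%g) F) => x; have [a aF Wa] := FP x^-1%g.
by exists a^-1%g; [exact: map_f|exact: We].
Qed.

Definition sup_ap_metric : ap_metric R G :=
  APMetric sup_dist_refl sup_dist_sym sup_dist_tri sup_dist_le1 sup_dist_mull
    sup_dist_mulr sup_dist_nbhs sup_dist_net.

End sup_metric.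

Lemma totally_bounded_precompact : hausdorff_space G -> precompact_group G.
Proof.
move=> hG; apply: (@ap_separated_precompact R) => // V V1.
have V'1 : nbhs 1%g [set u | V u^-1%g] by exact: nbhs1_inv.
have [|f [f01 f1 fV fruc]] := @right_uniform_urysohn R G [set 1%g] [set b | ~ V b] _ V'1.
  by move=> _ b -> /= nVb; rewrite mul1g invgK.
(* The radius [1] works: [f] is [0] at [1] and [1] off [V], so a point off [V] is at distance at
   least [1] from the identity. *)
exists (sup_ap_metric f01 fruc), 1; split => // u /= u1; apply: contrapT => /fV fu.
have := sup_dist_ge f01 u 1%g 1%g 1%g; rewrite !mulg1 mul1g fu f1// subr0 normr1.
by rewrite leNgt u1.
Qed.

End totally_bounded_groups.

(** * From precompact groups to weakly almost periodic actions *)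

Lemma subgroup_totally_bounded (G : topologicalGroupType) :
  precompact_group G -> totally_bounded_group G.
Proof.
move=> [K [H [hK cK _ [phi [psi [phiK psiK phiM _ psi_cont]]]]]] V V1.
pose i g : K := set_val (phi g).
have iM x y : i (x * y)%g = (i x * i y)%g by exact: phiM.
have i1 : i 1%g = 1%g by apply: (mulIg (i 1%g)); rewrite -iM !mul1g.
have iV x : i x^-1%g = (i x)^-1%g by apply: (mulIg (i x)); rewrite -iM !mulVg.
have [B B1 BV] : exists2 B : set K, nbhs 1%g B & forall g, B (i g) -> V g.
  have := psi_cont (phi 1%g) V; rewrite phiK => /(_ V1).
  move=> [_ [[B oB <-] /= B1 BV]]; exists B.
    by apply: open_nbhs_nbhs; split => //; rewrite -i1.
  by move=> g Bg; rewrite -(phiK g); exact: (BV (phi g)).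
have [W W1 WB] := nbhs1_div B1.
apply: contrapT => /forallNP nF.
(* Without a finite cover there is a sequence whose terms are pairwise [V]-apart. Its image clusters
   at some [k] in [K], and two terms near [k] contradict this. *)
have [s|u uV] := @dependent_sequence G (fun s x => forall a, a \in s -> ~ V (a^-1 * x)%g).
  have /existsNP[x /forall2NP xs] := nF s; exists x => a as_ aV.
  by have [] := xs a.
have [k [_ k_clu]] := cK ((i \o u) @ \oo) _ filterT.
have kW : nbhs k [set x | W (k^-1 * x)^-1%g].
  apply: (@mulgl_continuous K k^-1%g k [set y | W y^-1%g]); rewrite mulVg.
  exact: nbhs1_inv.
have [_ [[n _ <-] Wn]] := k_clu [set (i \o u) n | n in setT] _
  (filterE _ (fun n => ex_intro2 _ _ n Logic.I erefl)) kW.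
have [_ [[m /= nm <-] Wm]] := k_clu [set (i \o u) m | m in [set m | (n < m)%N]] _
  (ex_intro2 _ _ n.+1 Logic.I (fun m nm => ex_intro2 _ _ m nm erefl)) kW.
apply: (uV m (u n)); first by apply: map_f; rewrite mem_iota.
apply: BV; rewrite iM iV.
by have := WB _ _ Wn Wm; rewrite /= !invgM !invgK -!mulgA mulVKg.
Qed.

Section equicontinuous_orbits.
Variables (R : realType) (G : topologicalGroupType) (X : topologicalType).
Variable act : G -> X -> X.
Hypotheses (cX : compact [set: X]) (act_cont : continuous_action act).
Variable f : X -> R[i]^o.
Hypothesis f_cont : continuous f.

Lemma compact_bounded_complex : f \in @bounded_functions R X.
Proof.
apply/bounded_functionsP; move/compact_near_coveringP: cX => cov.
have := cov nat (nbhs \oo) (fun n x => normc (f x) <= n%:R) _.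
case=> [x _|n _ /(_ n (leqnn n)) nP]; last by exists n%:R => x; exact: nP.
have fx : nbhs x [set y | normc (f y - f x) < 1].
  by have /complex_cvgP := @f_cont x; apply; exact: ltr01.
have [n fxn] : exists n : nat, normc (f x) + 1 <= n%:R.
  exists (Num.truncn (normc (f x) + 1)).+1; apply/ltW/truncnS_gt.
exists ([set y | normc (f y - f x) < 1], [set m | (n <= m)%N]).
  by split => //; exists n.
move=> [y m] [/= fy nm]; apply: (@le_trans _ _ n%:R); last by rewrite ler_nat.
apply: le_trans fxn; rewrite -(subrK (f x) (f y)) (le_trans (le_normcD _ _))// addrC.
by rewrite lerD2l ltW.
Qed.

(** A tube argument: joint continuity at each [(1, x)] gives a product neighbourhood, and
    compactness of [X] makes the neighbourhood of [1] uniform in [x]. *)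
Lemma action_uniform (e : R) : 0 < e ->
  nbhs 1%g [set g | forall x, normc (f (act g x) - f x) <= e].
Proof.
move=> e0; have e20 : 0 < e / 2 by rewrite divr_gt0.
move/compact_near_coveringP: cX => cov.
have [[act1 _] act_c] := act_cont.
suff cvP x : [set: X] x ->
    \forall y \near x & g \near (1%g : G), normc (f (act g y) - f y) <= e.
  have covg : nbhs (1%g : G) [set g | [set: X] `<=` [set y | normc (f (act g y) - f y) <= e]].
    exact: (cov G (nbhs (1%g : G)) (fun g y => normc (f (act g y) - f y) <= e) _ cvP).
  by apply: filterS covg => g gP x; exact: gP.
move=> _.
have fx : nbhs x [set y | normc (f y - f x) < e / 2].
  by have /complex_cvgP := @f_cont x; apply.
have := act_c (1%g, x) [set y | normc (f y - f x) < e / 2].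
rewrite /= act1 => /(_ fx)[[A B] [/= A1 Bx] ABf].
exists (B `&` [set y | normc (f y - f x) < e / 2], A) => /=.
  by split => //; exact: filterI.
move=> [y g] [/= [By fy] Ag]; have fgy := ABf (g, y) (conj Ag By).
rewrite -(subrKA (f x)) (le_trans (le_normcD _ _))// [leRHS]splitr lerD// ltW//.
by rewrite normcB.
Qed.

Lemma totally_bounded_wap : totally_bounded_group G -> weakly_almost_periodic act f.
Proof.
move=> tbG; exists (Linfty compact_bounded_complex) => //.
apply: norm_totally_bounded_weak_precompact => e e0.
have [F FP] := tbG _ (nbhs1_inv (action_uniform e0)).
exists [seq translate act a (Linfty compact_bounded_complex) | a <- F].
move=> _ [g _ <-]; have [a aF /= ga] := FP g.
exists (translate act a (Linfty compact_bounded_complex)).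
  exact: (map_f (fun a => translate act a _)).
(* With [y = a^-1 x], the translates by [g] and [a] differ at [x] by [f ((g^-1 a) y) - f y], and
   [g^-1 a] is small. *)
move=> x; have := ga (act a^-1%g x); have [[_ actM] _] := act_cont.
by rewrite -actM invgM invgK mulgK.
Qed.

End equicontinuous_orbits.

(** * The compact space generated by a right uniformly continuous function *)

Section ruc_compactification.
Variables (R : realType) (G : topologicalGroupType) (f : G -> R[i]^o).

(* A pointwise closed condition that holds for the functions [h |-> f (h x)] and makes
   the family equicontinuous; it replaces the closure of their set. *)
Definition dominated_by_translates (phi : G -> R[i]^o) : Prop :=
  (forall c : R, (forall x, normc (f x) <= c) -> forall a, normc (phi a) <= c) /\
  (forall a b (c : R), (forall x, normc (f (a * x)%g - f (b * x)%g) <= c) ->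
     normc (phi a - phi b) <= c).

Definition ruc_compactification : Type := {phi | dominated_by_translates phi}.
Local Notation X := ruc_compactification.

HB.instance Definition _ := gen_eqMixin X.
HB.instance Definition _ := gen_choiceMixin X.

Let coordinate (h : G) (p : X) : R[i]^o := sval p h.

HB.instance Definition _ := Topological.copy X
  (sup_topology (fun h => Topological.on (initial_topology (coordinate h)))).

Lemma ruc_compactification_eqP (p q : X) : (forall h, sval p h = sval q h) -> p = q.
Proof. by case: p q => [p hp] [q hq] pq; apply: eq_exist; exact/funext. Qed.

Lemma ruc_compactification_cvgP (F : set_system X) {FF : Filter F} (p : X) :
  F --> p <-> forall h, (fun q : X => sval q h) @ F --> (sval p h : R[i]^o).
Proof. exact: (@sup_initial_cvgP _ _ _ coordinate F FF p). Qed.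

Lemma ruc_coordinate_continuous h : continuous (fun p : X => sval p h : R[i]^o).
Proof. exact: (@sup_initial_continuous _ _ _ coordinate h). Qed.

Lemma ruc_compactification_hausdorff : hausdorff_space X.
Proof.
apply: (@sup_initial_hausdorff _ _ R[i]^o coordinate) => [|p q pq].
  exact: norm_hausdorff.
exact: ruc_compactification_eqP.
Qed.

Lemma ruc_compactification_compact (M : R) :
  (forall x, normc (f x) <= M) -> compact [set: X].
Proof.
move=> fM; rewrite compact_ultra => U UU _.
have /choice[phi phiP] h : exists l : R[i]^o, (fun p : X => sval p h : R[i]^o) @ U --> l.
  have [p|l [Ul _]] := @ultra_bounded_cvg _ X U (fun p => sval p h : R[i]^o) M UU.
    exact: (svalP p).1.
  by exists l.
have phi_near h (e : R) : 0 < e -> U [set p : X | normc (sval p h - phi h) < e].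
  by move=> e0; have /complex_cvgP := @phiP h; apply.
have hphi : dominated_by_translates phi.
  split=> [c fc a|a b c fc]; apply/ler_addgt0Pr => e e0.
    have [p /= pa] := filter_ex (phi_near a e e0).
    have := (svalP p).1 c fc a; rewrite normcB in pa.
    have := le_normcD (phi a - sval p a) (sval p a); rewrite subrK; lra.
  have e20 : 0 < e / 2 by rewrite divr_gt0.
  have [p [/= pa pb]] := filter_ex (filterI (phi_near a _ e20) (phi_near b _ e20)).
  have := (svalP p).2 a b c fc; rewrite normcB in pa.
  have := le_normcD (phi a - sval p a) (sval p a - sval p b); rewrite subrKA.
  have := le_normcD (phi a - sval p b) (sval p b - phi b); rewrite subrKA.
  lra.
exists (exist _ phi hphi); split => //.
by apply/ruc_compactification_cvgP => h; exact: phiP.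
Qed.

Lemma dominated_translate (g : G) (phi : G -> R[i]^o) :
  dominated_by_translates phi -> dominated_by_translates (fun h => phi (h * g)%g).
Proof.
move=> [phi_bnd phi_lip]; split => [c fc a|a b c fc]; first exact: phi_bnd.
by apply: phi_lip => x; rewrite -!mulgA.
Qed.

(** Translating the variable on the right is a left action, and it makes [ruc_point] equivariant for
    left translation. *)
Definition ruc_action (g : G) (p : X) : X :=
  exist dominated_by_translates (fun h => sval p (h * g)%g) (dominated_translate g (svalP p)).

Lemma dominated_orbit (x : G) : dominated_by_translates (fun h => f (h * x)%g).
Proof. by split=> [c fc a|a b c fc]; [exact: fc|exact: fc]. Qed.

Definition ruc_point (x : G) : X := exist dominated_by_translates _ (dominated_orbit x).

Lemma ruc_actionE g x : ruc_action g (ruc_point x) = ruc_point (g * x)%g.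
Proof. by apply: ruc_compactification_eqP => h /=; rewrite mulgA. Qed.

Lemma ruc_action_continuous : right_uniformly_continuous f -> continuous_action ruc_action.
Proof.
move=> [_ f_ruc]; split.
  split=> [p|g h p]; apply: ruc_compactification_eqP => k /=; first by rewrite mulg1.
  by rewrite mulgA.
move=> [g p]; apply/(@ruc_compactification_cvgP _ (fmap_filter _ (nbhs_filter (g, p)))) => h.
apply/complex_cvgP => e e0; have e20 : 0 < e / 2 by rewrite divr_gt0.
have [V V1 fV] := f_ruc _ e20.
exists ([set g' | V (h * (g * g'^-1) * h^-1)%g],
        [set q : X | normc (sval q (h * g)%g - sval p (h * g)%g) < e / 2]).
  split => /=; last first.
    have /complex_cvgP := @ruc_coordinate_continuous (h * g)%g p.
    by apply.
  exact: (@nbhs1_right _ [set u | V (h * u * h^-1)%g] g (nbhs1_conj h V1)).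
move=> [g' q] [/= hV qp].
(* Domination bounds this variation of [q] by that of [f], uniformly in [q]: this equicontinuity is
   what makes the action jointly continuous. *)
have : normc (sval q (h * g')%g - sval q (h * g)%g) <= e / 2.
  apply: (svalP q).2 => x; rewrite -lecR; apply/ltW/fV.
  by rewrite !invgM !mulgA mulgK in hV *.
have := le_normcD (sval q (h * g')%g - sval q (h * g)%g) (sval q (h * g)%g - sval p (h * g)%g).
rewrite subrKA; lra.
Qed.

(** Evaluation at [1] is a continuous function on the compactification whose pullback along
    [ruc_point] is [f]. The pullback carries its orbit onto that of [f], and the weakly compact
    closure of the former to a weakly compact set. *)
Lemma ruc_wap : bounded_fun f -> right_uniformly_continuous f ->
    (hausdorff_space X -> compact [set: X] -> continuous_action ruc_action ->
      weakly_almost_periodic_action R ruc_action) ->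
  weakly_almost_periodic (@left_translation G) f.
Proof.
move=> f_bnd f_ruc wap.
have fB : f \in @bounded_functions R G by rewrite /bounded_functions inE.
have [M fM] := (bounded_functionsP f).1 fB.
have [] := wap ruc_compactification_hausdorff (ruc_compactification_compact fM)
  (ruc_action_continuous f_ruc) (fun p => sval p 1%g).
  exact: ruc_coordinate_continuous.
move=> F FE FO; rewrite precompactE in FO.
exists (pullback ruc_point F); first by apply/funext => x; rewrite /= FE /= mul1g.
pose cl := @closure (weakTopology (linfty R X)) (orbit_of ruc_action F).
apply: (@weak_precompact_sub _ _ _ (pullback ruc_point @` cl)).
  move=> _ [g _ <-]; exists (translate ruc_action g F).
    by apply: subset_closure; exists g.
  by apply: linfty_eqP => x; rewrite /= ruc_actionE.
apply: (@continuous_compact (weakTopology (linfty R X)) (weakTopology (linfty R G))) => //.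
by apply: continuous_subspaceT; exact: pullback_weak_continuous.
Qed.

End ruc_compactification.

Theorem theorem4p5 (R : realType) (G : topologicalGroupType)
    (hG : hausdorff_space G) :
  [<-> (* (1) *)
       forall (X : topologicalType) (act : G -> X -> X),
         hausdorff_space X -> compact [set: X] -> continuous_action act ->
         weakly_almost_periodic_action R act ;
       (* (2) *)
       forall f : G -> R[i]^o,
         bounded_fun f -> right_uniformly_continuous f ->
         weakly_almost_periodic (@left_translation G) f ;
       (* (3) *)
       precompact_group G ].
Proof.
tfae=> [wap f f_bnd f_ruc|wap|pG X act _ cX act_cont f f_cont].
- by apply: ruc_wap => //; exact: wap.
- exact: (totally_bounded_precompact R (wap_totally_bounded wap) hG).
- apply: (totally_bounded_wap cX act_cont f_cont).
  exact: subgroup_totally_bounded.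
Qed.
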